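(* Let $R$ be an associative ring with unity. The following are equivalent: (1) $R$ is left noetherian; (2) the AEC $(R\text{-AbsP},\leq_p)$ of absolutely pure left $R$-modules with pure embeddings is superstable; (3) the AEC $(R\text{-l-inj},\leq_p)$ of locally injective left $R$-modules with pure embeddings is superstable.
   Context: $M\leq_p N$ means $M$ is a pure submodule of $N$ (every pp-formula, i.e. existentially quantified finite system of linear equations, with parameters in $M$ true in $N$ is true in $M$). A module is absolutely pure if it is a pure submodule of every module containing it. A module $M$ is locally injective if every finite tuple of $M$ is contained in an injective submodule of $M$. For an AEC $\mathbf{K}=(K,\leq_p)$ of modules: $M$ is universal over $N$ if $\|M\|=\|N\|=\lambda$, $N\leq_p M$, and every $N^*\in K$ of cardinality $\lambda$ with $N\leq_p N^*$ embeds purely into $M$ over $N$. For a limit ordinal $\alpha<\lambda^+$, $M$ is a $(\lambda,\alpha)$-limit model if there is an increasing continuous chain $\{M_i:i<\alpha\}$ of models of $K$ of cardinality $\lambda$ with $M=\bigcup_{i<\alpha}M_i$ and $M_{i+1}$ universal over $M_i$; a $\lambda$-limit model is a $(\lambda,\alpha)$-limit model for some such $\alpha$. $\mathbf{K}$ is superstable if there is a cardinal $\mu$ such that for every $\lambda\geq\mu$, $\mathbf{K}$ has $\lambda$-limit models and any two $\lambda$-limit models are isomorphic. *)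

(* Defs.v *)
From HB Require Import structures.
From mathcomp Require Import all_boot all_algebra.
Set Implicit Arguments. Unset Strict Implicit. Unset Printing Implicit Defensive.
Import GRing.Theory.
Local Open Scope ring_scope.

Section Modules.
Variable R : nzRingType.

Definition submod (V : lmodType R) (S : pred V) : Prop :=
  0 \in S /\ (forall x y, x \in S -> y \in S -> x + y \in S) /\
  (forall (r : R) x, x \in S -> r *: x \in S).

(* f : V -> W is R-linear on the submodule S (values off S irrelevant). *)
Definition lin_on (V W : lmodType R) (S : pred V) (f : V -> W) : Prop :=
  (forall x y, x \in S -> y \in S -> f (x + y) = f x + f y) /\
  (forall (r : R) x, x \in S -> f (r *: x) = r *: f x).

Definition emb (V W : lmodType R) (S : pred V) (T : pred W) (f : V -> W) : Prop :=
  lin_on S f /\ (forall x, x \in S -> f x \in T) /\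
  (forall x y, x \in S -> y \in S -> f x = f y -> x = y).

Definition pp_lhs (V : lmodType R) (k n m : nat) (A : 'I_k -> 'I_n -> R)
  (B : 'I_k -> 'I_m -> R) (a : 'I_n -> V) (b : 'I_m -> V) (r : 'I_k) : V :=
  \sum_(j < n) A r j *: a j + \sum_(l < m) B r l *: b l.

(* f is a pure embedding of S (inside V) into T (inside W): every pp-formula
   exists y, A x + B y = 0 with parameters in S true in T is true in S. *)
Definition pure_emb (V W : lmodType R) (S : pred V) (T : pred W) (f : V -> W) : Prop :=
  emb S T f /\
  forall (k n m : nat) (A : 'I_k -> 'I_n -> R) (B : 'I_k -> 'I_m -> R)
         (a : 'I_n -> V),
    (forall j, a j \in S) ->
    (exists b : 'I_m -> W, (forall l, b l \in T) /\
        forall r, pp_lhs A B (fun j => f (a j)) b r = 0) ->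
    exists b : 'I_m -> V, (forall l, b l \in S) /\
        forall r, pp_lhs A B a b r = 0.

Definition absP (V : lmodType R) (S : pred V) : Prop :=
  submod S /\
  forall (W : lmodType R) (f : V -> W), emb S predT f -> pure_emb S predT f.

Definition inj_submod (V : lmodType R) (T : pred V) : Prop :=
  submod T /\
  forall (A B : lmodType R) (i : A -> B) (g : A -> V),
    emb predT predT i -> lin_on predT g -> (forall x, g x \in T) ->
    exists h : B -> V, lin_on predT h /\ (forall y, h y \in T) /\
                       forall x, h (i x) = g x.

Definition linj (V : lmodType R) (S : pred V) : Prop :=
  submod S /\
  forall (n : nat) (a : 'I_n -> V), (forall j, a j \in S) ->
    exists T : pred V, inj_submod T /\ {subset T <= S} /\ forall j, a j \in T.

Definition card_eq (V : lmodType R) (S : pred V) (L : Type) : Prop :=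
  exists f : {x : V | x \in S} -> L, bijective f.

Definition card_le (A B : Type) : Prop := exists f : A -> B, injective f.

Definition wellorder (A : Type) (lt : A -> A -> Prop) : Prop :=
  (forall x, ~ lt x x) /\ (forall x y z, lt x y -> lt y z -> lt x z) /\
  (forall x y, lt x y \/ x = y \/ lt y x) /\ well_founded lt.

Definition is_succ (A : Type) (lt : A -> A -> Prop) (i j : A) : Prop :=
  lt i j /\ forall k, lt i k -> k = j \/ lt j k.

Definition is_limit (A : Type) (lt : A -> A -> Prop) (i : A) : Prop :=
  (exists j, lt j i) /\ forall j, lt j i -> exists k, lt j k /\ lt k i.

Definition cls := forall V : lmodType R, pred V -> Prop.

Definition universal (K : cls) (L : Type) (M : lmodType R) (N Mp : pred M) : Prop :=
  card_eq N L /\ card_eq Mp L /\ {subset N <= Mp} /\ pure_emb N Mp id /\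
  forall (W : lmodType R) (g : M -> W),
    K W predT -> card_eq (@predT W) L -> pure_emb N predT g ->
    exists h : W -> M, pure_emb predT Mp h /\ forall x, x \in N -> h (g x) = x.

(* M is a (L, alpha)-limit model for some limit ordinal alpha < L^+ :
   alpha is represented by a well-ordered type (A, lt) which is nonempty, has
   no maximum (limit ordinal) and injects into L (|alpha| <= L), and the chain
   (C i)_{i<alpha} of submodules of M is increasing, continuous, with union M,
   each C (i+1) universal over C i. *)
Definition limit_model (K : cls) (L : Type) (M : lmodType R) : Prop :=
  exists (A : Type) (lt : A -> A -> Prop) (C : A -> pred M),
    [/\ wellorder lt, (exists a : A, True), (forall i, exists j, lt i j)
      & card_le A L] /\
    [/\ (forall i, submod (C i) /\ K M (C i) /\ card_eq (C i) L),
        (forall i j, lt i j -> {subset C i <= C j} /\ pure_emb (C i) (C j) id),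
        (forall i, is_limit lt i ->
           forall x, x \in C i <-> exists j, lt j i /\ x \in C j),
        (forall x, exists i, x \in C i)
      & (forall i j, is_succ lt i j -> universal K L (C i) (C j))].

Definition mod_iso (M1 M2 : lmodType R) : Prop :=
  exists f : M1 -> M2, lin_on predT f /\ bijective f.

Definition superstable (K : cls) : Prop :=
  exists mu : Type, forall L : Type, card_le mu L ->
    (exists M : lmodType R, limit_model K L M) /\
    (forall M1 M2 : lmodType R,
        limit_model K L M1 -> limit_model K L M2 -> mod_iso M1 M2).

Definition left_ideal (I : pred R) : Prop :=
  0 \in I /\ (forall x y, x \in I -> y \in I -> x + y \in I) /\
  (forall r x, x \in I -> r * x \in I).

Definition left_noetherian : Prop :=
  forall I : pred R, left_ideal I ->
    exists (n : nat) (g : 'I_n -> R),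
      forall x, x \in I <-> exists c : 'I_n -> R, x = \sum_(j < n) c j * g j.

End Modules.

(* Main.v *)
(* Over a noetherian ring the absolutely pure modules, the locally injective modules and the injective modules coincide, and directed unions of injective modules are injective. Every injective module is therefore built, one direct summand at a time, from injective modules of bounded size, all of which embed in a single injective module E. In each large cardinality the direct sums of copies of E indexed by {0, ..., n} x L then form a chain whose union is a limit model, and two limit models embed in each other, hence are isomorphic by Bumby's theorem.

Conversely, let I_0 < I_1 < ... be left ideals with union I, and let L be a large cardinal with L < L^omega. A model C_1 universal over a model of size L contains elements x_(n,l), l in L, with I_n x_(n,l) = 0, independent and with r_n x_(n,l) <> 0 for some r_n in I_(n+1). Every sequence eta : omega -> L gives a homomorphism r |-> sum_n r x_(n, eta n) from I to C_1. In a model universal over C_1 all these are multiplications by an element, and different sequences need different elements. So that model has at least L^omega elements, and there is no limit model of size L. *)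
Require Import Defs.
From HB Require Import structures.
From mathcomp Require Import all_boot all_order all_algebra.
From mathcomp Require Import boolp classical_sets functions.
From mathcomp Require cardinality.
Set Implicit Arguments. Unset Strict Implicit. Unset Printing Implicit Defensive.
Import GRing.Theory.
Local Open Scope ring_scope.
Local Open Scope classical_set_scope.

(** [Zorn_bigcup] must also accept the empty chain, so the empty set is adjoined to [P]. It changes
    no union of a chain with a nonempty member, and it cannot be maximal because the nonempty [A0]
    satisfies [P]. *)
Lemma Zorn_above (T : Type) (P : set (set T)) (A0 : set T) :
  A0 !=set0 -> P A0 ->
  (forall F : set (set T), F !=set0 -> F `<=` P ->
     (forall X, F X -> A0 `<=` X) ->
     total_on F (fun X Y => X `<=` Y) -> P (\bigcup_(X in F) X)) ->
  exists A, [/\ P A, A0 `<=` A & forall B, A `<=` B -> P B -> B `<=` A].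
Proof.
move=> [a0 A0a] PA0 Pchain.
pose P' X := X = set0 \/ (P X /\ A0 `<=` X).
have [F FP' Ftot|A [PA maxA]] := @Zorn_bigcup T P'.
  have [[X FX [x Xx]]|noX] := pselect (exists2 X, F X & X !=set0); last first.
    left; rewrite -subset0 => x [X FX Xx]; case: noX; exists X => //; by exists x.
  pose F' := F `&` [set X | X !=set0].
  have F'P X' : F' X' -> P X' /\ A0 `<=` X'.
    by move=> [/FP' [->|//] [y]].
  have -> : \bigcup_(X in F) X = \bigcup_(X in F') X.
    rewrite eqEsubset; split=> y [Y FY Yy]; first by exists Y => //; split => //; exists y.
    by exists Y => //; case: FY.
  right; split; last first.
    move=> y A0y; exists X; first by split => //; exists x.
    by have [|_] := F'P X; [split => //; exists x|apply].
  apply: Pchain.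
  - by exists X; split => //; exists x.
  - by move=> Y /F'P [].
  - by move=> Y /F'P [].
  - by move=> Y Z [FY _] [FZ _]; apply: Ftot.
case: PA => [A00|[PA A0A]].
  case: (maxA A0); last by right; split.
  by rewrite A00; split=> // /(_ a0 A0a).
exists A; split=> // B AB PB b Bb; apply: contrapT => nAb.
case: (maxA B); last by right; split => //; apply: subset_trans A0A AB.
by split=> // /(_ b Bb).
Qed.

(** * Baer's criterion *)

Section Baer.
Variable R : nzRingType.
Implicit Types V W B : lmodType R.

Definition subm V (S : set V) : Prop :=
  [/\ S 0, forall x y, S x -> S y -> S (x + y) & forall (r : R) x, S x -> S (r *: x)].

Definition linear_on V W (S : set V) (f : V -> W) : Prop :=
  (forall x y, S x -> S y -> f (x + y) = f x + f y) /\
  (forall (r : R) x, S x -> f (r *: x) = r *: f x).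

(** The working form of injectivity, tested on left ideals and relative to a subset of an ambient
    module; [inj_submodP] identifies it with the extension property. *)
Definition baer V (T : set V) : Prop :=
  subm T /\
  forall (I : set R^o) (phi : R^o -> V), subm I -> linear_on I phi ->
    (forall x, I x -> T (phi x)) ->
    exists2 t, T t & forall x : R^o, I x -> phi x = (x : R) *: t.

Lemma submN V (S : set V) x : subm S -> S x -> S (- x).
Proof. by move=> [_ _ SZ] Sx; rewrite -scaleN1r; apply: SZ. Qed.

Lemma submB V (S : set V) x y : subm S -> S x -> S y -> S (x - y).
Proof. by move=> sS Sx /(submN sS); case: sS => _ SD _; apply: SD. Qed.

Lemma linear_onB V W (S : set V) (f : V -> W) x y : subm S -> linear_on S f ->
  S x -> S y -> f (x - y) = f x - f y.
Proof.
move=> [_ _ SZ] [fD fZ] Sx Sy.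
by rewrite -scaleN1r fD ?fZ ?scaleN1r // -scaleN1r; apply: SZ.
Qed.

Lemma linear_on0 V W (S : set V) (f : V -> W) : subm S -> linear_on S f -> f 0 = 0.
Proof. by move=> sS fl; rewrite -(subrr 0) (linear_onB sS fl) ?subrr //; case: sS. Qed.

Lemma linear_on_linear V W (S : set V) (f : {linear V -> W}) : linear_on S f.
Proof. by split=> [x y _ _|r x _]; rewrite (linearD, linearZ). Qed.

Lemma pack_linear V W (f : V -> W) : linear_on [set: V] f ->
  exists g : {linear V -> W}, forall x, g x = f x.
Proof.
move=> [fD fZ].
have fl : linear f by move=> r x y; rewrite fD // fZ.
pose g : {linear V -> W} := HB.pack_for {linear V -> W} f (GRing.isLinear.Build R V W *:%R f fl).
by exists g.
Qed.

(** Partial linear maps are handled as graphs, submodules of [B * V]. The difference of two pairs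
    over [b] is a pair over 0, so single-valuedness is tested there only. *)
Lemma graph_fun B V (G : set (B * V)) b v v' : subm G ->
  (forall v, G (0, v) -> v = 0) -> G (b, v) -> G (b, v') -> v = v'.
Proof.
move=> sG G0 Gv Gv'; apply/eqP; rewrite -subr_eq0; apply/eqP/G0.
by have := submB sG Gv Gv'; rewrite -[X in G X]/(b - b, v - v') subrr.
Qed.

Lemma subm_chain V (F : set (set V)) : F !=set0 -> (forall X, F X -> subm X) ->
  total_on F (fun X Y => X `<=` Y) -> subm (\bigcup_(X in F) X).
Proof.
move=> [X FX] Fs Ftot; split.
- by exists X => //; case: (Fs _ FX).
- move=> x y [Y FY Yx] [Z FZ Zy].
  have [/(_ _ Yx) Zx|/(_ _ Zy) Yy] := Ftot _ _ FY FZ.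
    by exists Z => //; have [_ ZD _] := Fs _ FZ; apply: ZD.
  by exists Y => //; have [_ YD _] := Fs _ FY; apply: YD.
- by move=> r x [Y FY Yx]; exists Y => //; have [_ _ YZ] := Fs _ FY; apply: YZ.
Qed.

(** By Zorn, [G0] has a maximal extension [G] with values in [T]. For any [b], the scalars [r] with
    [r *: b] in its domain form a left ideal, on which [G] amounts to multiplication by some [t].
    Sending [b] to [t] extends [G], so [b] was in the domain already. *)
Lemma baer_ext B V (T : set V) (G0 : set (B * V)) : baer T -> subm G0 ->
  (forall v, G0 (0, v) -> v = 0) -> (forall p, G0 p -> T p.2) ->
  exists h : {linear B -> V}, (forall b, T (h b)) /\ forall b v, G0 (b, v) -> h b = v.
Proof.
move=> [[T0 TD TZ] Tb] sG0 G00 G0T.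
pose P (G : set (B * V)) :=
  [/\ subm G, (forall v, G (0, v) -> v = 0) & (forall p, G p -> T p.2)].
have [|//|F F0 FP _ Ftot|G [[sG Gf GT] G0G maxG]] := @Zorn_above _ P G0.
- by exists 0; case: sG0.
- split.
  + by apply: subm_chain => // X /FP [].
  + by move=> v [X /FP [_ X0 _]]; apply: X0.
  + by move=> p [X /FP [_ _]]; apply.
have [G00' GD GZ] := sG.
have tot b : exists v, G (b, v).
  pose I : set R^o := [set r | exists v, G ((r : R) *: b, v)].
  have /choice [phi phiP] : forall r : R^o, exists v, I r -> G ((r : R) *: b, v).
    by move=> r; have [[v Gv]|nI] := pselect (I r); [exists v|exists 0].
  have sI : subm I.
    split; first by exists 0; rewrite scale0r.
    - by move=> x y [v Gv] [w Gw]; exists (v + w); rewrite scalerDl; apply: (GD _ _ Gv Gw).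
    - by move=> r x [v Gv]; exists (r *: v); have := GZ r _ Gv; rewrite -[X in G X]/(r *: (x *: b), r *: v) scalerA.
  have [_ ID IZ] := sI.
  have [|x Ix|t Tt phit] := Tb I phi sI.
  - split=> [x y Ix Iy|r x Ix]; apply: (graph_fun sG Gf (phiP _ _)).
    + exact: ID.
    + by rewrite scalerDl; apply: (GD _ _ (phiP _ Ix) (phiP _ Iy)).
    + exact: IZ.
    + by have := GZ r _ (phiP _ Ix); rewrite -[X in G X]/(r *: (x *: b), r *: phi x) scalerA.
  - exact: (GT _ (phiP _ Ix)).
  pose G' : set (B * V) := [set p | exists d v (r : R), G (d, v) /\ p = (d + r *: b, v + r *: t)].
  have GG' : G `<=` G'.
    by move=> [d v] Gdv; exists d, v, 0; rewrite !scale0r !addr0.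
  exists t; apply: (maxG G' GG'); last first.
    by exists 0, 0, 1; rewrite !scale1r !add0r.
  split; first split.
  - exact: GG'.
  - move=> _ _ [d [v [r [Gdv ->]]]] [d' [v' [r' [Gdv' ->]]]].
    exists (d + d'), (v + v'), (r + r'); split; first exact: (GD _ _ Gdv Gdv').
    by rewrite !scalerDl; congr (_, _); rewrite /= addrACA.
  - move=> s _ [d [v [r [Gdv ->]]]].
    exists (s *: d), (s *: v), (s * r); split; first exact: (GZ s _ Gdv).
    by rewrite -!scalerA; congr (_, _); rewrite /= scalerDr.
  (* Single-valuedness: [d + r *: b = 0] puts [- r] in [I], whence [v = phi (- r) = - r *: t]. *)
  - move=> w [d [v [r [Gdv [/esym/eqP dE ->]]]]].
    have {}dE : d = (- r) *: b by apply/eqP; rewrite scaleNr -addr_eq0.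
    have Ir : I (- r) by exists v; rewrite -dE.
    have := phit _ Ir; have -> : phi (- r) = v.
      by apply: (graph_fun sG Gf (phiP _ Ir)); rewrite -dE.
    by move=> ->; rewrite scaleNr addNr.
  - by move=> _ [d [v [r [Gdv ->]]]]; apply: TD; [apply: (GT _ Gdv)|apply: TZ].
have /choice [h hP] := tot.
have [|h' h'E] := @pack_linear _ _ h.
  split=> [x y _ _|r x _]; apply: (graph_fun sG Gf (hP _)).
    exact: (GD _ _ (hP x) (hP y)).
  exact: (GZ r _ (hP x)).
exists h'; split=> [b|b v G0v]; rewrite h'E; first exact: (GT _ (hP b)).
exact: (graph_fun sG Gf (hP b) (G0G _ G0v)).
Qed.

End Baer.

(** * Injective modules *)

Section RationalsModIntegers.
Import Order.TTheory Num.Theory.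
Local Open Scope quotient_scope.

Definition int_rat : {pred rat} := [pred q | q \is a Num.int].
Fact int_rat_zmod_closed : zmod_closed int_rat.
Proof. by split=> [|x y]; rewrite !inE ?rpred0 //; apply: rpredB. Qed.
HB.instance Definition _ := GRing.isZmodClosed.Build rat int_rat int_rat_zmod_closed.

Definition QZ : zmodType := Quotient.quot int_rat.
Definition piQZ (q : rat) : QZ := \pi_(QZ) q.

Lemma piQZD q r : piQZ (q + r) = piQZ q + piQZ r.
Proof. by rewrite /piQZ !piE. Qed.

Lemma piQZ0 q : piQZ q = 0 <-> q \is a Num.int.
Proof.
have := Quotient.idealrBE int_rat q 0; rewrite subr0 => ->.
have <- : piQZ 0 = 0 by rewrite /piQZ !piE.
by split=> [/eqP|/eqP].
Qed.

Lemma piQZ_surj x : exists q, piQZ q = x.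
Proof. by exists (repr x); apply: reprK. Qed.

Lemma piQZMz q (n : int) : piQZ q *~ n = piQZ (q * n%:~R).
Proof.
have piQZMn m : piQZ q *+ m = piQZ (q *+ m).
  elim: m => [|m IH]; first by rewrite !mulr0n; apply/esym/piQZ0.
  by rewrite !mulrSr IH piQZD.
case: n => m; first by rewrite -pmulrn piQZMn mulr_natr.
rewrite NegzE mulrNz -pmulrn piQZMn -mulr_natr rmorphN mulrN.
by apply/eqP; rewrite eq_sym -addr_eq0 -piQZD addNr; apply/eqP/piQZ0.
Qed.

Lemma QZ_divisible (n : int) (x : QZ) : n != 0 -> exists t : QZ, t *~ n = x.
Proof.
move=> n0; have [q <-] := piQZ_surj x.
by exists (piQZ (q / n%:~R)); rewrite piQZMz divfK ?intr_eq0.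
Qed.

Lemma QZ_order (n : nat) : (0 < n)%N -> exists c : QZ, forall k : int, c *~ k = 0 <-> (n %| k)%Z.
Proof.
move=> n0; exists (piQZ (n%:R)^-1) => k; rewrite piQZMz.
have nR : (n%:R : rat) != 0 by rewrite pnatr_eq0 -lt0n.
split=> [/piQZ0 /intrP [m mE]|/dvdzP [m ->]].
  apply/dvdzP; exists m; apply/eqP; rewrite -(eqr_int rat) rmorphM /= -mE.
  by rewrite mulrC mulrA pmulrn divff // mul1r.
by apply/piQZ0; rewrite rmorphM /= mulrC -mulrA pmulrn divff // mulr1.
Qed.

(** Division with remainder by the least positive element; the zero ideal gets [d = 0], which
    divides only 0. *)
Lemma int_ideal (I : set int) : @subm int (int^o)%type I ->
  exists2 d : nat, I d%:Z & forall x, I x -> (d %| x)%Z.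
Proof.
move=> sI; have [I0 ID IZ] := sI.
have [[x Ix x0]|nI] := pselect (exists2 x, I x & x != 0); last first.
  exists 0%N => // x Ix; have [->//|x0] := eqVneq x 0.
  by case: nI; exists x.
pose P (n : nat) := (0 < n)%N && `[< I n%:Z >].
have exP : exists n, P n.
  exists `|x|%N; rewrite /P absz_gt0 x0 /=; apply/asboolP.
  rewrite abszE; have := IZ (Num.sg x) _ Ix.
  by rewrite -[X in I X]/(Num.sg x * x) -normrEsg.
case: (ex_minnP exP) => d /andP[d0 /asboolP Id] dmin; exists d => // y Iy.
apply/dvdz_mod0P.
have Ir : I (y %% d)%Z.
  have -> : (y %% d)%Z = y - (y %/ d)%Z * d.
    by rewrite [X in X - _](divz_eq y d) addrAC subrr add0r.
  by apply: (submB sI) => //; apply: (IZ (y %/ d)%Z).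
have r0 : 0 <= (y %% d)%Z by rewrite modz_ge0 // gt_eqF.
have rd : (y %% d)%Z < d by rewrite ltz_pmod.
move: Ir r0 rd; case: (y %% d)%Z => // m Im _; rewrite ltz_nat => md.
have [->//|m0] := posnP m.
have : P m by rewrite /P m0; apply/asboolP.
by move=> /dmin; rewrite leqNgt md.
Qed.

Lemma baer_QZ : @baer int (zmodule QZ) setT.
Proof.
split=> // I phi sI [phiD phiZ] _.
have [d Id dI] := int_ideal sI.
have [d0|d0] := eqVneq (d : int) 0.
  exists 0 => // x Ix; have /dI := Ix; rewrite d0 dvd0z => /eqP ->; rewrite scale0r.
  exact: (linear_on0 sI).
have [t tE] := QZ_divisible (phi d%:Z : QZ) d0.
exists t => // x Ix; have /dI /dvdzP [k ->] := Ix.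
rewrite (_ : k * d%:Z = k *: (d%:Z : int^o)) // phiZ // -tE.
by rewrite -[in RHS]scalerA.
Qed.

(** The map sending [s + k *: x] to [k *: c] is extended by [baer_ext]. It is well defined once [c]
    is killed by the ideal [I] of all [k] with [k *: x] in [S]. *)
Lemma QZ_cogenerator (V : lmodType int) (S : set V) x : subm S -> ~ S x ->
  exists2 chi : {linear V -> zmodule QZ}, (forall s, S s -> chi s = 0) & chi x <> 0.
Proof.
move=> sS nSx; have [S0 SD SZ] := sS.
pose I : set int := [set k | S (k *: x)].
have sI : @subm int (int^o)%type I.
  split; first by rewrite /I /= scale0r.
    by move=> k l Ik Il; rewrite /I /= scalerDl; apply: SD.
  by move=> k l Il; rewrite /I /= -scalerA; apply: SZ.
have [d Id dI] := int_ideal sI.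
have d1 : d <> 1%N by move=> E; apply: nSx; have := Id; rewrite E /I /= scale1r.
(* If [x] has finite order [d] modulo [S], [c] is given the same order. If [d = 0], the ideal is
   zero and any nonzero [c] will do, here one of order 2. *)
have [c c0 cI] : exists2 c : zmodule QZ, c <> 0 & forall k, I k -> k *: c = 0.
  have [d0|d0] := posnP d.
    have [c cE] := @QZ_order 2 isT; exists c.
      by move=> c0; have /cE : c *~ 1 = 0 by rewrite mulr1z.
    by move=> k /dI; rewrite d0 dvd0z => /eqP ->; rewrite scale0r.
  have [c cE] := QZ_order d0; exists c.
    move=> c0; have /cE : c *~ 1 = 0 by rewrite mulr1z.
    by rewrite dvdzE /= dvdn1 => /eqP.
  by move=> k /dI /cE.
pose G : set (V * zmodule QZ) := [set p | exists s k, S s /\ p = (s + k *: x, k *: c)].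
have [||p _//|chi [_ chiE]] := @baer_ext int V (zmodule QZ) setT G baer_QZ.
- split; first by exists 0, 0; rewrite !scale0r addr0.
    move=> _ _ [s [k [Ss ->]]] [s' [k' [Ss' ->]]]; exists (s + s'), (k + k').
    split; first exact: SD.
    by rewrite !scalerDl; congr (_, _); rewrite /= addrACA.
  move=> r _ [s [k [Ss ->]]]; exists (r *: s), (r * k); split; first exact: SZ.
  by rewrite -!scalerA; congr (_, _); rewrite /= scalerDr.
- move=> v [s [k [Ss [/esym/eqP sE ->]]]]; apply: cI.
  rewrite /I /= -[k *: x]opprK; apply: (submN sS).
  by move: sE; rewrite addr_eq0 => /eqP <-.
exists chi => [s Ss|].
  by apply: chiE; exists s, 0; rewrite !scale0r addr0.
by rewrite (chiE x c) //; exists 0, 1; rewrite !scale1r add0r.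
Qed.

End RationalsModIntegers.

(** * Character modules *)

Section CharacterModule.
Variables (R : nzRingType) (X : Type).

(** The product of [X] copies of Hom_Z(R, Q/Z). A scalar acts by right multiplication on the
    argument, which makes this a left module. *)
Record charmod := Charmod {
  charfun :> R -> X -> QZ;
  charfunD : forall r s x, charfun (r + s) x = charfun r x + charfun s x }.

HB.instance Definition _ := gen_eqMixin charmod.
HB.instance Definition _ := gen_choiceMixin charmod.

Implicit Types f g h : charmod.

Lemma charmodP f g : (forall r x, f r x = g r x) -> f = g.
Proof.
case: f g => [f fD] [g gD] /= fg.
have E : f = g by apply/funext => r; apply/funext => x; apply: fg.
by rewrite -E in gD *; rewrite (Prop_irrelevance fD gD).
Qed.

Definition charmod0 : charmod.
Proof. by exists (fun _ _ => 0) => *; rewrite addr0. Defined.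
Definition charmod_add f g : charmod.
Proof. by exists (fun r x => f r x + g r x) => *; rewrite !charfunD addrACA. Defined.
Definition charmod_opp f : charmod.
Proof. by exists (fun r x => - f r x) => *; rewrite charfunD opprD. Defined.
Definition charmod_scale (a : R) f : charmod.
Proof. by exists (fun r x => f (r * a) x) => *; rewrite mulrDl charfunD. Defined.

Fact charmod_addA : associative charmod_add.
Proof. by move=> f g h; apply: charmodP => r x /=; rewrite addrA. Qed.
Fact charmod_addC : commutative charmod_add.
Proof. by move=> f g; apply: charmodP => r x /=; rewrite addrC. Qed.
Fact charmod_add0 : left_id charmod0 charmod_add.
Proof. by move=> f; apply: charmodP => r x /=; rewrite add0r. Qed.
Fact charmod_addN : left_inverse charmod0 charmod_opp charmod_add.
Proof. by move=> f; apply: charmodP => r x /=; rewrite addNr. Qed.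
HB.instance Definition _ :=
  GRing.isZmodule.Build charmod charmod_addA charmod_addC charmod_add0 charmod_addN.

Fact charmod_scaleA a b f : charmod_scale a (charmod_scale b f) = charmod_scale (a * b) f.
Proof. by apply: charmodP => r x /=; rewrite mulrA. Qed.
Fact charmod_scale1 : left_id 1 charmod_scale.
Proof. by move=> f; apply: charmodP => r x /=; rewrite mulr1. Qed.
Fact charmod_scaleDr : right_distributive charmod_scale +%R.
Proof. by move=> a f g; apply: charmodP. Qed.
Fact charmod_scaleDl f : {morph charmod_scale^~ f : a b / a + b}.
Proof. by move=> a b; apply: charmodP => r x /=; rewrite mulrDr charfunD. Qed.
HB.instance Definition _ := GRing.Zmodule_isLmodule.Build R charmod
  charmod_scaleA charmod_scale1 charmod_scaleDr charmod_scaleDl.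

Lemma charmod_addE f g r x : (f + g) r x = f r x + g r x. Proof. by []. Qed.
Lemma charmod_scaleE (a : R) f r x : (a *: f) r x = f (r * a) x. Proof. by []. Qed.

Lemma subm_zmodule (V : lmodType R) (S : set V) :
  subm S -> @subm int (zmodule V) S.
Proof.
move=> [S0 SD SZ]; split=> // k v Sv.
rewrite (_ : k *: (v : zmodule V) = (k%:~R : R) *: v); last by rewrite scaler_int.
exact: SZ.
Qed.

(** Since [phi r s x = phi (s * r) 1 x], the map [phi] is determined by the additive maps
    [r |-> phi r 1 x]. These extend from [I] to [R] because Q/Z is injective, and the extensions
    together form the required element. *)
Lemma baer_charmod : baer [set: charmod].
Proof.
split=> // I phi sI [phiD phiZ] _.
have sI' := subm_zmodule sI; have [I0' ID' IZ'] := sI'.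
have phizZ k v : I v -> phi (k *: (v : zmodule R^o)) = (k *: (phi v : zmodule charmod)).
  move=> Iv; rewrite (_ : k *: (v : zmodule R^o) = (k%:~R : R) *: v); last by rewrite scaler_int.
  by rewrite phiZ // scaler_int.
have charmodMz f k r x : (f *~ k) r x = f r x *~ k.
  have Mn m : (f *+ m) r x = f r x *+ m.
    by elim: m => [|m IH]; rewrite ?mulr0n // !mulrSr charmod_addE IH.
  case: k => m; first by rewrite -!pmulrn Mn.
  by rewrite NegzE !mulrNz -!pmulrn -Mn.
have ext x : exists chi : {linear zmodule R^o -> zmodule QZ},
    forall r, I r -> chi r = phi r 1 x.
  pose G : set (zmodule R^o * zmodule QZ) := [set p | I p.1 /\ p.2 = phi p.1 1 x].
  have [||p _//|chi [_ chiE]] := @baer_ext int _ _ setT G baer_QZ.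
  - split.
    + split; first by case: sI.
      by rewrite /= (linear_on0 sI (conj phiD phiZ)).
    + move=> [r u] [s v] [/= Ir /= ->] [/= Is /= ->]; split => /=; first exact: ID'.
      by rewrite phiD.
    + move=> k [r u] [/= Ir /= ->]; split => /=; first exact: IZ'.
      by rewrite phizZ // -[X in _ = charfun X _ _]/(phi r *~ k) charmodMz.
  - by move=> v [/= _ /= ->]; rewrite (linear_on0 sI (conj phiD phiZ)).
  - by exists chi => r Ir; apply: chiE.
have {ext} /choice [chi chiE] := ext.
have chiD r s x : chi x (r + s) = chi x r + chi x s by apply: linearD.
exists (@Charmod (fun r x => chi x r) chiD) => // r Ir.
apply: charmodP => s x; rewrite charmod_scaleE /= chiE ?phiZ ?charmod_scaleE ?mul1r //.
by case: sI => _ _; apply.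
Qed.

(** The coordinate at [x] is [r |-> chi (r *: v)], for a character [chi] that is nonzero at [tau x]
    unless [tau x = 0]. The target depends on the index type only, so all modules enumerated by [X]
    embed in one injective module. *)
Lemma charmod_embed (V : lmodType R) (tau : X -> V) :
  exists f : {linear V -> charmod}, forall x, f (tau x) = 0 -> tau x = 0.
Proof.
have ex v : exists chi : {linear zmodule V -> zmodule QZ}, chi v = 0 -> v = 0.
  have [v0|v0] := pselect (v = 0); first by exists \0.
  have [|chi _ chiv] := @QZ_cogenerator (zmodule V) [set 0] v _ v0; last by exists chi.
  by split=> //= [x y -> ->|r x ->]; rewrite ?addr0 ?scaler0.
have /choice [chi chiE] := ex.
have fD (v : V) (r s : R) x :
    chi (tau x) ((r + s) *: v : V) = chi (tau x) (r *: v : V) + chi (tau x) (s *: v : V).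
  by rewrite scalerDl; apply: linearD.
have [|f fE] := @pack_linear R V charmod (fun v => @Charmod (fun r x => chi (tau x) (r *: v : V)) (fD v)).
  split=> [v w _ _|r v _]; apply: charmodP => s x.
    by rewrite /= scalerDr; apply: linearD.
  by rewrite charmod_scaleE /= scalerA.
exists f => x; rewrite fE => E; apply: chiE.
by have := congr1 (fun g : charmod => g 1 x) E; rewrite /= scale1r.
Qed.

End CharacterModule.

Lemma enough_injectives (R : nzRingType) (V : lmodType R) :
  exists (W : lmodType R) (f : {linear V -> W}), baer [set: W] /\ forall v, f v = 0 -> v = 0.
Proof.
have [f f0] := @charmod_embed R V V id.
by exists (charmod R V), f; split; first exact: baer_charmod.
Qed.

(** [e] is a character of [R] vanishing on [I] but not at [r]; the value of [r *: e] at 1 is that of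
    [e] at [r]. *)
Lemma ideal_separation (R : nzRingType) (I : set R^o) (r : R) : subm I -> ~ I r ->
  exists e : charmod R unit, (forall i : R, I i -> i *: e = 0) /\ r *: e <> 0.
Proof.
move=> sI nIr; have sIz := subm_zmodule sI.
have [chi chi0 chir] := QZ_cogenerator sIz nIr.
have eD (a b : R) (x : unit) : chi (a + b : R^o) = chi (a : R^o) + chi (b : R^o) by apply: linearD.
exists (Charmod eD); split=> [i Ii|re].
  by apply: charmodP => s x; rewrite charmod_scaleE /=; apply: chi0; case: sI => _ _; apply.
apply: chir.
by have := congr1 (fun g : charmod R unit => g 1 tt) re; rewrite charmod_scaleE /= mul1r.
Qed.

(** * Submodules as modules in their own right *)

Section SubmoduleType.
Variables (R : nzRingType) (V : lmodType R) (S : set V) (sS : subm S).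

Record submodule_type := Submodule { submodule_val : V; submodule_valP : S submodule_val }.
HB.instance Definition _ := gen_eqMixin submodule_type.
HB.instance Definition _ := gen_choiceMixin submodule_type.
Implicit Types x y z : submodule_type.

Lemma submodule_val_inj x y : submodule_val x = submodule_val y -> x = y.
Proof.
by case: x y => [x Sx] [y Sy] /= E; rewrite -E in Sy *; rewrite (Prop_irrelevance Sx Sy).
Qed.

Let S0 : S 0. Proof. by case: sS. Qed.
Let SD x y : S (submodule_val x + submodule_val y).
Proof. by case: sS x y => _ SD _ [x Sx] [y Sy]; apply: SD. Qed.
Let SN x : S (- submodule_val x). Proof. by apply: submN => //; case: x. Qed.
Let SZ (r : R) x : S (r *: submodule_val x).
Proof. by case: sS => _ _; apply; case: x. Qed.

Let zero := Submodule S0.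
Let add x y := Submodule (SD x y).
Let opp x := Submodule (SN x).
Let scale r x := Submodule (SZ r x).

Let addA : associative add.
Proof. by move=> *; apply: submodule_val_inj; rewrite /= addrA. Qed.
Let addC : commutative add.
Proof. by move=> *; apply: submodule_val_inj; rewrite /= addrC. Qed.
Let add0 : left_id zero add.
Proof. by move=> *; apply: submodule_val_inj; rewrite /= add0r. Qed.
Let addN : left_inverse zero opp add.
Proof. by move=> *; apply: submodule_val_inj; rewrite /= addNr. Qed.
Let scaleA r s x : scale r (scale s x) = scale (r * s) x.
Proof. by apply: submodule_val_inj; rewrite /= scalerA. Qed.
Let scale1 : left_id 1 scale.
Proof. by move=> *; apply: submodule_val_inj; rewrite /= scale1r. Qed.
Let scaleDr : right_distributive scale add.
Proof. by move=> *; apply: submodule_val_inj; rewrite /= scalerDr. Qed.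
Let scaleDl x r s : scale (r + s) x = add (scale r x) (scale s x).
Proof. by apply: submodule_val_inj; rewrite /= scalerDl. Qed.

Lemma submodule_lmod :
  exists (W : lmodType R) (f : {linear W -> V}), injective f /\ range f = S.
Proof.
pose Z : zmodType := HB.pack submodule_type
  (GRing.isZmodule.Build submodule_type addA addC add0 addN).
pose W : lmodType R := HB.pack submodule_type Z
  (GRing.Zmodule_isLmodule.Build R Z scaleA scale1 scaleDr scaleDl).
have [//|f fE] := @pack_linear R W V submodule_val.
exists W, f; split; first by move=> x y; rewrite !fE; apply: submodule_val_inj.
rewrite eqEsubset; split=> [_ [x _ <-]|x Sx]; first by rewrite fE; case: x.
by exists (Submodule Sx); rewrite ?fE.
Qed.

End SubmoduleType.

(** * Retracts, images, sums and summands of injective modules *)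

Section Baer_constructions.
Variable R : nzRingType.
Implicit Types V W : lmodType R.

Lemma subm_image V W (S : set V) (f : V -> W) : subm S -> linear_on S f -> subm (f @` S).
Proof.
move=> sS fl; have [S0 SD SZ] := sS; have [fD fZ] := fl.
split=> [|_ _ [x Sx <-] [y Sy <-]|r _ [x Sx <-]].
- by exists 0 => //; rewrite (linear_on0 sS).
- by exists (x + y); rewrite ?fD //; apply: SD.
- by exists (r *: x); rewrite ?fZ //; apply: SZ.
Qed.

Lemma baer_retract V W (T : set V) (T' : set W) (i : W -> V) (q : V -> W) :
  baer T -> subm T' -> linear_on T' i -> linear_on T q ->
  (forall x, T' x -> T (i x)) -> (forall x, T x -> T' (q x)) ->
  (forall x, T' x -> q (i x) = x) -> baer T'.
Proof.
move=> [[T0 TD TZ] bT] sT' [iD iZ] [qD qZ] iT qT qi; split=> // I phi sI [phiD phiZ] phiT.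
have [||t Tt tE] := bT I (i \o phi) sI.
- by split=> [x y Ix Iy|r x Ix] /=; rewrite ?phiD ?phiZ ?iD ?iZ //; apply: phiT.
- by move=> x Ix; apply/iT/phiT.
by exists (q t); [apply: qT|move=> x Ix; rewrite -qZ // -tE //= qi //; apply: phiT].
Qed.

Lemma baer_image V W (T : set V) (f : V -> W) : baer T -> linear_on T f ->
  (forall x, T x -> f x = 0 -> x = 0) -> baer (f @` T).
Proof.
move=> bT fl f0; have [sT _] := bT; have [T0 TD TZ] := sT; have [fD fZ] := fl.
have f_inj x y : T x -> T y -> f x = f y -> x = y.
  move=> Tx Ty fxy; apply/eqP; rewrite -subr_eq0; apply/eqP/f0; first exact: submB.
  by rewrite (linear_onB sT fl) // fxy subrr.
have /choice [i iP] : forall w, exists v, (f @` T) w -> T v /\ f v = w.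
  by move=> w; have [[v Tv vw]|nw] := pselect ((f @` T) w); [exists v|exists 0].
have fT x : T x -> (f @` T) (f x) by exists x.
apply: (@baer_retract _ _ T _ i f) => //.
- exact: subm_image.
- split=> [x y Tx Ty|r x Tx].
    have [[Tix ix] [Tiy iy]] := (iP _ Tx, iP _ Ty).
    have [|Tixy ixy] := iP (x + y).
      by rewrite -ix -iy -fD //; apply/fT/TD.
    by apply: f_inj => //; [exact: TD|rewrite fD // ixy ix iy].
  have [Tix ix] := iP _ Tx; have [|Tirx irx] := iP (r *: x).
    by rewrite -ix -fZ //; apply/fT/TZ.
  by apply: f_inj => //; [exact: TZ|rewrite fZ // irx ix].
- by move=> x /iP [].
- by move=> x /iP [].
Qed.

Lemma baer_prod V W (S : set V) (T : set W) : baer S -> baer T -> baer (S `*` T).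
Proof.
move=> [[S0 SD SZ] bS] [[T0 TD TZ] bT]; split; first split.
- by [].
- by move=> [x y] [x' y'] [/= Sx Ty] [/= Sx' Ty']; split; [apply: SD|apply: TD].
- by move=> r [x y] [/= Sx Ty]; split; [apply: SZ|apply: TZ].
move=> I phi sI [phiD phiZ] phiT.
have [||s Ss sE] := bS I (fun r => (phi r).1) sI.
- by split=> [x y Ix Iy|r x Ix]; rewrite ?phiD ?phiZ.
- by move=> x /phiT [].
have [||t Tt tE] := bT I (fun r => (phi r).2) sI.
- by split=> [x y Ix Iy|r x Ix]; rewrite ?phiD ?phiZ.
- by move=> x /phiT [].
exists (s, t) => // x Ix; rewrite [LHS]surjective_pairing sE // tE //.
Qed.

Lemma baer_sum V (S T : set V) : baer S -> baer T -> (forall x, S x -> T x -> x = 0) ->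
  baer [set x | exists s t, [/\ S s, T t & x = s + t]].
Proof.
move=> bS bT ST0; have [[S0 SD SZ] _] := bS; have [sT _] := bT.
have [T0 TD TZ] := sT.
have [||] := @baer_image (V * V)%type V (S `*` T) (fun p => p.1 + p.2) (baer_prod bS bT).
- by split=> [p q _ _|r p _]; rewrite ?scalerDr // addrACA.
- move=> [s t] [/= Ss Tt] /eqP; rewrite addr_eq0 => /eqP sE.
  have s0 : s = 0 by apply: ST0 => //; rewrite sE; apply: submN.
  by move: sE; rewrite s0 => /esym/eqP; rewrite oppr_eq0 => /eqP ->.
have -> : [set p.1 + p.2 | p in S `*` T] = [set x | exists s t, [/\ S s, T t & x = s + t]].
  rewrite eqEsubset; split=> [_ [[s t] [Ss Tt] <-]|_ [s [t [Ss Tt ->]]]].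
    by exists s, t.
  by exists (s, t).
by [].
Qed.

Lemma baer_projection V (T : set V) : baer T ->
  exists p : {linear V -> V}, (forall x, T (p x)) /\ forall x, T x -> p x = x.
Proof.
move=> bT; have [[T0 TD TZ] _] := bT.
pose G : set (V * V) := [set p | T p.1 /\ p.2 = p.1].
have [|||p [pT pE]] := @baer_ext R V V T G bT.
- split=> [//|[x y] [x' y'] [/= Tx ->] [/= Tx' ->]|r [x y] [/= Tx ->]].
    by split=> //; apply: TD.
  by split=> //; apply: TZ.
- by move=> v [].
- by move=> [x y] [/= Tx ->].
by exists p; split=> // x Tx; apply: pE.
Qed.

(** The kernel is a retract of [Q] by [x |-> x - p x]. *)
Lemma baer_kernel V (Q T : set V) (p : {linear V -> V}) : baer Q -> T `<=` Q ->
  (forall x, T (p x)) -> (forall x, T x -> p x = x) -> baer [set x | Q x /\ p x = 0].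
Proof.
move=> bQ TQ pT pE; have [sQ _] := bQ; have [Q0 QD QZ] := sQ.
apply: (@baer_retract _ _ Q _ id (fun x => x - p x)) => //.
- split=> [|x y [Qx px] [Qy py]|r x [Qx px]]; split; rewrite ?linear0 //.
  + exact: QD.
  + by rewrite linearD px py addr0.
  + exact: QZ.
  + by rewrite linearZ /= px scaler0.
- split=> [x y _ _|r x _].
    by rewrite linearD opprD addrACA.
  by rewrite linearZ /= scalerBr.
- by move=> x [].
- move=> x Qx; split; first by apply: (submB sQ) => //; apply/TQ.
  by rewrite linearB /= (pE (p x)) // subrr.
- by move=> x [_ ->]; rewrite subr0.
Qed.

Lemma submodP V (S : pred V) : submod S <-> subm [set x | x \in S].
Proof. by split=> [[S0 [SD SZ]]|[S0 SD SZ]]; split. Qed.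

(** Forward, a map on a left ideal is extended to all of [R] and [t] is the image of 1. Backward,
    [baer_ext] is applied to the graph of [g] composed with the inverse of [i]. *)
Lemma inj_submodP V (T : pred V) : inj_submod T <-> baer [set x | x \in T].
Proof.
split=> [[/submodP sT injT]|bT].
  split=> // I phi sI [phiD phiZ] phiT.
  have [A [i [i_inj iI]]] := submodule_lmod sI.
  have Ii a : I (i a) by rewrite -iI; exists a.
  have [|||h [[hD hZ] [hT hE]]] := injT A R^o i (phi \o i).
  - by split; [split=> *; rewrite ?linearD ?linearZ|split=> // x y _ _; apply: i_inj].
  - by split=> [x y _ _|r x _] /=; rewrite ?linearD ?linearZ /= ?phiD ?phiZ.
  - by move=> a; apply: phiT.
  exists (h 1); first exact: hT.
  move=> x; rewrite -iI => -[a _ <-].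
  by rewrite -hZ // -[_ *: 1]/((i a : R) * 1) mulr1 hE.
split=> [|A B i g [[iD iZ] [_ i_inj]] [gD gZ] gT].
  by apply/submodP; case: bT.
have i0 : i 0 = 0 by rewrite -(scale0r 0) iZ // scale0r.
have g0 : g 0 = 0 by rewrite -(scale0r 0) gZ // scale0r.
pose G : set (B * V) := [set p | exists a, p = (i a, g a)].
have [|||h [hT hE]] := @baer_ext R B V _ G bT.
- split=> [|_ _ [a ->] [b ->]|r _ [a ->]].
  + by exists 0; rewrite i0 g0.
  + by exists (a + b); rewrite iD // gD.
  + by exists (r *: a); rewrite iZ // gZ.
- move=> v [a [ia ->]]; rewrite (_ : a = 0) //.
  by apply: i_inj; rewrite // i0.
- by move=> _ [a ->]; apply: gT.
exists h; split; first by split=> *; rewrite ?linearD ?linearZ.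
by split=> // a; apply: hE; exists a.
Qed.

Lemma inj_submod_linj V (S : pred V) : inj_submod S -> linj S.
Proof.
move=> iS; have [sS _] := iS; split=> // n a aS; exists S; split=> //.
by split.
Qed.

(** A solution in [T] is a solution in [W]. Hence embeddings between members of the classes
    considered are automatically pure. *)
Lemma absP_pure_emb V W (S : pred V) (T : pred W) (f : V -> W) :
  absP S -> emb S T f -> pure_emb S T f.
Proof.
move=> [sS pS] ef; split=> // k n m A B a aS [b [bT bE]].
have [|_] := pS W f; first by case: ef => ? [? ?]; split.
by apply=> //; exists b.
Qed.

(* An injective [T] containing the parameters is a retract of the ambient module, so a solution can be projected into [T]. *)
Lemma linj_absP V (S : pred V) : linj S -> absP S.
Proof.
move=> [sS lS]; split=> // W f ef; split=> // k n m A B a aS [b [_ bE]].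
have [T [/inj_submodP bT [TS aT]]] := lS n a aS.
have [[T0 TD TZ] _] := bT.
have [[fD fZ] [_ f_inj]] := ef.
have f0 : f 0 = 0 by rewrite -(scale0r 0) fZ ?scale0r //; case: sS.
pose G : set (W * V) := [set p | p.2 \in T /\ p.1 = f p.2].
have [|||h [hT hE]] := @baer_ext R W V _ G bT.
- split=> [|[w v] [w' v'] [/= Tv ->] [/= Tv' ->]|r [w v] [/= Tv ->]].
  + by split.
  + by split; [apply: TD|rewrite /= fD //; apply: TS].
  + by split; [apply: TZ|rewrite /= fZ //; apply: TS].
- by move=> v [/= Tv]; rewrite -f0 => /esym; apply: f_inj; apply: TS.
- by move=> p [].
exists (fun l => h (b l)); split=> [l|r]; first exact/TS/hT.
rewrite -[RHS](linear0 h) -(bE r) /pp_lhs linearD !linear_sum.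
congr (_ + _); apply: eq_bigr => j _; rewrite linearZ //=.
by rewrite (hE _ (a j)) //; split; first exact: aT.
Qed.

End Baer_constructions.

(** * Noetherian rings *)

Section Noetherian.
Variable R : nzRingType.
Hypothesis noethR : left_noetherian R.
Implicit Types V W : lmodType R.

Lemma noetherian_fg (I : set R^o) : subm I -> exists (n : nat) (g : 'I_n -> R),
  (forall j, I (g j)) /\ forall x, I x -> exists c : 'I_n -> R, x = \sum_(j < n) c j * g j.
Proof.
move=> [I0 ID IZ].
have [|n [g gP]] := noethR (I := [pred x : R | `[< I x >]]).
  split; first by rewrite inE.
  split=> [x y|r x]; rewrite !inE => Ix; last exact: IZ.
  exact: ID.
exists n, g; split=> [j|x Ix]; last by apply/gP; rewrite inE.
suff : g j \in [pred x : R | `[< I x >]] by rewrite inE.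
apply/gP; exists (fun i => (i == j)%:R).
rewrite (bigD1 j) //= eqxx mul1r big1 ?addr0 // => i /negPf ->.
by rewrite mul0r.
Qed.

(** A linear map on [I] is determined by its values on finitely many generators, so only finitely
    many equations have to be solved. *)
Lemma noetherian_baer V (T : set V) : subm T ->
  (forall (I : set R^o) (phi : R^o -> V) n (g : 'I_n -> R), subm I -> linear_on I phi ->
     (forall x, I x -> T (phi x)) -> (forall j, I (g j)) ->
     (forall x, I x -> exists c : 'I_n -> R, x = \sum_(j < n) c j * g j) ->
     exists2 t, T t & forall j, phi (g j) = g j *: t) -> baer T.
Proof.
move=> sT H; split=> // I phi sI phil phiT.
have [n [g [gI Ig]]] := noetherian_fg sI.
have [t Tt tE] := H I phi n g sI phil phiT gI Ig.
exists t => // x /Ig [c ->].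
have [phiD phiZ] := phil; have [I0 ID IZ] := sI.
rewrite scaler_suml.
suff : I (\sum_(j < n) c j * g j) /\ phi (\sum_(j < n) c j * g j) = \sum_(j < n) (c j * g j) *: t by case.
elim/big_ind2: _ => [|x1 x2 y1 y2 [Ix xE] [Iy yE]|j _].
- by rewrite (linear_on0 sI phil).
- by rewrite phiD // xE yE; split=> //; apply: ID.
- by split; [exact: IZ|rewrite phiZ // tE scalerA].
Qed.

Lemma linear_on_fg V (T : set V) (I : set R^o) (phi : R^o -> V) n (g : 'I_n -> R) :
  subm T -> subm I -> linear_on I phi -> (forall j, I (g j)) ->
  (forall x, I x -> exists c : 'I_n -> R, x = \sum_(j < n) c j * g j) ->
  (forall j, T (phi (g j))) -> forall x, I x -> T (phi x).
Proof.
move=> [T0 TD TZ] sI phil gI Ig phigT x /Ig [c ->].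
have [phiD phiZ] := phil; have [I0 ID IZ] := sI.
suff : I (\sum_(j < n) c j * g j) /\ T (phi (\sum_(j < n) c j * g j)) by case.
elim/big_ind: _ => [|y z [Iy Ty] [Iz Tz]|j _].
- by rewrite (linear_on0 sI phil).
- by rewrite phiD //; split; [apply: ID|apply: TD].
- by split; [exact: IZ|rewrite phiZ //; apply: TZ].
Qed.

(** In an injective extension [W] the equations at the generators of [I] have a common solution. As
    they are finitely many and their parameters lie in [S], purity yields a solution in [S]. *)
Lemma noetherian_absP_baer V (S : pred V) : absP S -> baer [set x | x \in S].
Proof.
move=> [sS pS]; have [W [f [bW f0]]] := enough_injectives V.
have [|_ pf] := pS W f.
  split; first by split=> *; rewrite ?linearD ?linearZ.
  split=> // x y _ _ fxy; apply/eqP; rewrite -subr_eq0; apply/eqP/f0.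
  by rewrite linearB /= fxy subrr.
apply: noetherian_baer; first exact/submodP.
move=> I phi n g sI [phiD phiZ] phiS gI _.
have [_ bW'] := bW; have [||w _ wE] := bW' I (f \o phi) sI => //.
  by split=> [x y Ix Iy|r x Ix] /=; rewrite ?phiD ?phiZ ?linearD ?linearZ.
(* The pp-formula says that some [y] satisfies [phi (g r) - g r *: y = 0] for all [r]: [n]
   equations, [n] parameters and one unknown. *)
have := pf n n 1%N (fun r j => (r == j)%:R) (fun r _ => - g r) (fun j => phi (g j)).
have sum_delta (U : lmodType R) (a : 'I_n -> U) r : \sum_(j < n) (r == j)%:R *: a j = a r.
  rewrite (bigD1 r) //= eqxx scale1r big1 ?addr0 // => i.
  by rewrite eq_sym => /negPf ->; rewrite scale0r.
case=> [j|//|b [bS bE]]; first exact: phiS.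
  exists (fun _ => w); split=> // r.
  by rewrite /pp_lhs sum_delta big_ord1 scaleNr -wE ?subrr //; apply: gI.
exists (b ord0); first exact: bS.
move=> j; apply/eqP; rewrite -subr_eq0 -scaleNr.
by have := bE j; rewrite /pp_lhs sum_delta big_ord1 => ->.
Qed.

Lemma directed_finite (T : Type) (F : set (set T)) n (v : 'I_n -> T) : F !=set0 ->
  total_on F (fun X Y => X `<=` Y) ->
  (forall j, (\bigcup_(X in F) X) (v j)) -> exists2 X, F X & forall j, X (v j).
Proof.
move=> [X0 FX0] Ftot; elim: n v => [|n IH] v vF; first by exists X0 => // -[].
have [X FX Xv] := IH (fun j => v (lift ord0 j)) (fun j => vF _).
have [Y FY Yv] := vF ord0.
have [XY|YX] := Ftot _ _ FX FY.
  by exists Y => // j; case: (unliftP ord0 j) => [k|] -> //; apply/XY/Xv.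
by exists X => // j; case: (unliftP ord0 j) => [k|] -> //; apply/YX.
Qed.

(** The values of [phi] at the finitely many generators of [I] lie in one member of the chain, hence
    so do all its values. *)
Lemma noetherian_baer_bigcup V (F : set (set V)) : F !=set0 ->
  total_on F (fun X Y => X `<=` Y) -> (forall X, F X -> baer X) ->
  baer (\bigcup_(X in F) X).
Proof.
move=> F0 Ftot Fb.
have sF : subm (\bigcup_(X in F) X) by apply: subm_chain => // X /Fb [].
apply: noetherian_baer => // I phi n g sI phil phiF gI Ig.
have [|X FX Xphi] := @directed_finite V F n (fun j => phi (g j)) F0 Ftot.
  by move=> j; apply/phiF/gI.
have [sX bX] := Fb _ FX.
have [x Ix|t Xt tE] := bX I phi sI phil; first exact: (linear_on_fg sX sI phil gI Ig).
by exists t; [exists X|move=> j; apply: tE].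
Qed.

End Noetherian.

(** * Small injective and locally injective submodules *)

Section Terms.
Variable R : nzRingType.
Implicit Types V W : lmodType R.

(* Names for the elements of an injective module generated by countably many elements: [Sol I f] names a solution of the possibly infinite system [f r = r x], [r] in [I]. *)
Inductive term : Type :=
| Gen of nat
| Add of term & term
| Scale of R & term
| Sol of (R -> Prop) & (R -> term).

Section Interp.
Variables (W : lmodType R) (Q : set W).

(** The default 0 is returned for an unsolvable system; it lies in [Q] too when [Q] is a
    submodule. *)
Definition solution (I : R -> Prop) (a : R -> W) : W :=
  xget 0 [set w | Q w /\ forall r, I r -> a r = r *: w].

Fixpoint interp (env : nat -> W) (t : term) : W :=
  match t with
  | Gen n => env n
  | Add s t => interp env s + interp env t
  | Scale r t => r *: interp env t
  | Sol J f => solution J (fun r => interp env (f r))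
  end.

Fixpoint subst (sigma : nat -> term) (t : term) : term :=
  match t with
  | Gen n => sigma n
  | Add s t => Add (subst sigma s) (subst sigma t)
  | Scale r t => Scale r (subst sigma t)
  | Sol J f => Sol J (fun r => subst sigma (f r))
  end.

Lemma interp_subst env sigma t :
  interp env (subst sigma t) = interp (fun n => interp env (sigma n)) t.
Proof.
elim: t => [//|s IHs t IHt|r t IH|I f IH] /=; rewrite ?IHs ?IHt ?IH //.
by congr solution; apply/funext => r; apply: IH.
Qed.

Hypothesis bQ : baer Q.

Lemma interp_in env t : (forall n, Q (env n)) -> Q (interp env t).
Proof.
move=> Qenv; have [[Q0 QD QZ] _] := bQ.
elim: t => [//|s IHs t IHt|r t IH|I f IH] /=; [exact: QD|exact: QZ|].
by rewrite /solution; case: xgetP => [w _ []|_].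
Qed.

(** If [f] picks a term for each value of [phi] on [I], then [Sol I f] names an element that
    represents [phi]. *)
Lemma baer_interp env : (forall n, Q (env n)) -> baer (range (interp env)).
Proof.
move=> Qenv; have [_ bQ'] := bQ; split.
  split=> [|_ _ [s _ <-] [t _ <-]|r _ [t _ <-]].
  - by exists (Scale 0 (Gen 0)); rewrite //= scale0r.
  - by exists (Add s t).
  - by exists (Scale r t).
move=> I phi sI phil phiT.
have /choice [f fE] : forall r, exists t, I r -> interp env t = phi r.
  by move=> r; have [/phiT [t _ <-]|nI] := pselect (I r); [exists t|exists (Gen 0)].
have [x Ix|w Qw wE] := bQ' I phi sI phil; first by rewrite -fE //; apply: interp_in.
exists (interp env (Sol I f)); first by exists (Sol I f).
rewrite /= /solution; case: xgetP => [u _ [_ uE] r Ir|/(_ w) []]; first by rewrite -fE // uE.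
by split=> // r Ir; rewrite fE // wE.
Qed.

End Interp.

(** [S] is the union of the injective modules generated by finite lists of the [X j]. Over a general
    ring such a union may fail to be injective, but it is directed by concatenation of lists, hence
    locally injective. A list and a term name each element, which bounds the size. *)
Lemma linj_hull W (J : Type) (X : J -> W) : baer [set: W] -> exists S : pred W,
  [/\ linj S, forall j, X j \in S
    & exists enum : seq J * term -> W, forall w, w \in S -> exists p, enum p = w].
Proof.
move=> bW.
pose env s n := nth 0 (map X s) n.
pose span s := range (interp [set: W] (env s)).
pose S : pred W := fun w => `[< exists s, span s w >].
have SP w : reflect (exists s, span s w) (w \in S) by apply: asboolP.
have bspan s : baer (span s) by apply: baer_interp.
have span_catl s s' : span s `<=` span (s ++ s').
  move=> _ [t _ <-].
  (* Indices past the end of [s] have value 0 in [env s] but may point into [s'] in [env (s ++ s')],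
     so they are replaced by a term of value 0. *)
  exists (subst (fun n => if (n < size s)%N then Gen n else Scale 0 (Gen 0)) t) => //.
  rewrite interp_subst; congr (interp _ _ t); apply/funext => n; rewrite /env map_cat.
  case: ifP => ns /=; rewrite ?nth_cat ?size_map ?ns //.
  by rewrite scale0r nth_default // size_map leqNgt ns.
have span_catr s s' : span s' `<=` span (s ++ s').
  move=> _ [t _ <-]; exists (subst (fun n => Gen (size s + n)) t) => //.
  rewrite interp_subst; congr (interp _ _ t); apply/funext => n; rewrite /env map_cat /=.
  by rewrite nth_cat size_map ltnNge leq_addr /= addKn.
have spanS s : {subset [pred w | `[< span s w >]] <= S}.
  by move=> w; rewrite inE => sw; apply/SP; exists s.
exists S; split.
- split.
    split; first by apply/SP; exists [::]; case: (bspan [::]) => -[].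
    split=> [x y /SP [s sx] /SP [s' sy]|r x /SP [s sx]]; apply/SP.
      exists (s ++ s'); have [[_ D _] _] := bspan (s ++ s').
      by apply: D; [apply: span_catl|apply: span_catr].
    by exists s; have [[_ _ Z] _] := bspan s; apply: Z.
  move=> n a aS.
  suff [s sa] : exists s, forall j, span s (a j).
    exists [pred w | `[< span s w >]]; split; last first.
      by split=> [|j]; [exact: spanS|rewrite inE; apply: sa].
    apply/inj_submodP; rewrite (_ : [set _ | _] = span s) //.
    by apply/seteqP; split=> w; rewrite /= inE.
  elim: n a aS => [|n IH] a aS; first by exists [::] => -[].
  have [s sa] := IH (fun j => a (lift ord0 j)) (fun j => aS _).
  have /SP [s' sa'] := aS ord0.
  exists (s ++ s') => j; case: (unliftP ord0 j) => [k|] ->.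
    by apply: span_catl; apply: sa.
  exact: span_catr.
- by move=> j; apply/SP; exists [:: j]; exists (Gen 0).
- exists (fun p => interp [set: W] (env p.1) p.2) => w /SP [s [t _ <-]].
  by exists (s, t).
Qed.

End Terms.

(** * Cardinals *)

Lemma card_le_trans (A B C : Type) : card_le A B -> card_le B C -> card_le A C.
Proof. by move=> [f f_inj] [g g_inj]; exists (g \o f); apply: inj_comp. Qed.

Lemma card_le_surj (A B : Type) (f : A -> B) : (forall b, exists a, f a = b) -> card_le B A.
Proof.
by move=> /choice [g fg]; exists g => x y gxy; rewrite -(fg x) gxy fg.
Qed.

Lemma card_le_prod (A B C D : Type) : card_le A C -> card_le B D -> card_le (A * B) (C * D).
Proof.
move=> [f f_inj] [g g_inj]; exists (fun p => (f p.1, g p.2)).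
by move=> [x y] [x' y'] [/f_inj -> /g_inj ->].
Qed.

Lemma card_le_seq (A B : Type) : card_le A B -> card_le (seq A) (seq B).
Proof. by move=> [f f_inj]; exists (map f); apply: inj_map. Qed.

Lemma card_le_antisym (A B : Type) : card_le A B -> card_le B A ->
  exists f : A -> B, bijective f.
Proof.
have le_set (T U : Type) : card_le T U -> cardinality.card_le [set: T] [set: U].
  move=> [f f_inj].
  rewrite -(cardinality.card_le_eql (cardinality.inj_card_eq (in2W f_inj))).
  exact: cardinality.subset_card_le.
move=> /le_set AB /le_set BA.
have [f [g fK gK]] := cardinality.card_bijP (cardinality.Cantor_Bernstein AB BA).
have in_setT (T : Type) (x : T) : x \in [set: T] by rewrite inE.
exists (fun a => \val (f (exist _ a (in_setT _ a)))).
exists (fun b => \val (g (exist _ b (in_setT _ b)))) => x.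
  set y := f _; rewrite (_ : exist _ _ _ = y); last exact: val_inj.
  by rewrite /y fK.
set y := g _; rewrite (_ : exist _ _ _ = y); last exact: val_inj.
by rewrite /y gK.
Qed.

(** A maximal graph of a partial injection between [A] and [B] exhausts [A] or [B]; otherwise one
    more pair could be added. *)
Lemma set_comparable (T : Type) (A B : set T) :
  (exists2 j : T -> T, (forall x, A x -> B (j x)) &
     forall x y, A x -> A y -> j x = j y -> x = y) \/
  (exists2 j : T -> T, (forall x, B x -> A (j x)) &
     forall x y, B x -> B y -> j x = j y -> x = y).
Proof.
pose P (G : set (T * T)) := (forall p, G p -> A p.1 /\ B p.2) /\
  forall p q, G p -> G q -> p.1 = q.1 <-> p.2 = q.2.
have [F FP Ftot|G [[GAB Ginj] maxG]] := @Zorn_bigcup _ P.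
  split=> [p [X /FP [XAB _]]|p q [X FX Xp] [Y FY Yq]]; first exact: XAB.
  have [XY|YX] := Ftot _ _ FX FY; first by have [_] := FP _ FY; apply=> //; apply: XY.
  by have [_] := FP _ FX; apply=> //; apply: YX.
have [Atot|] := pselect (forall x, exists y, A x -> G (x, y)).
  left; have /choice [j jP] := Atot; exists j => [x /jP /GAB []|x y /jP Gx /jP Gy jxy] //.
  exact/(Ginj _ _ Gx Gy).
move=> /existsNP [a aN].
have Aa : A a by apply: contrapT => nA; apply: aN; exists a.
have Ga y : ~ G (a, y) by move=> Gay; apply: aN; exists y.
right; suff /choice [j jP] : forall y, exists x, B y -> G (x, y).
  exists j => [x /jP /GAB []|x y /jP Gx /jP Gy jxy] //.
  exact/(Ginj _ _ Gx Gy).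
move=> b; apply: contrapT => bN.
have Bb : B b by apply: contrapT => nB; apply: bN; exists b.
have Gb x : ~ G (x, b) by move=> Gxb; apply: bN; exists x.
apply: (maxG (G `|` [set (a, b)])).
  by split=> [p Gp|]; [left|move=> /(_ (a, b) (or_intror erefl)) /Ga].
split=> [p [/GAB //|->//]|p q [Gp|->] [Gq|->] //=]; first exact: Ginj.
- split=> [pa|pb]; [case: (Ga p.2)|case: (Gb p.1)].
    by rewrite -pa -surjective_pairing.
  by rewrite -pb -surjective_pairing.
- split=> [qa|qb]; [case: (Ga q.2)|case: (Gb q.1)].
    by rewrite qa -surjective_pairing.
  by rewrite qb -surjective_pairing.
Qed.

(** Zorn on injective pairings [G] of [X * X] into [X], for subsets [X] of [L], starting from a
    countable one. The set [X] is recovered as [fld G], the points whose diagonal pair is coded. *)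
Lemma card_le_square (L : Type) : card_le nat L -> card_le (L * L) L.
Proof.
move=> [i i_inj].
pose fld (G : set (L * L * L)) : set L := [set x | exists y, G ((x, x), y)].
pose P (G : set (L * L * L)) :=
  [/\ forall p q, G p -> G q -> p.1 = q.1 <-> p.2 = q.2,
      forall p, G p -> [/\ fld G p.1.1, fld G p.1.2 & fld G p.2]
    & forall x y, fld G x -> fld G y -> exists z, G ((x, y), z)].
pose code (m n : nat) : nat := pickle (m, n).
have code_inj m n m' n' : code m n = code m' n' -> (m, n) = (m', n').
  exact: (pcan_inj (@pickleK (nat * nat)%type)).
pose G0 : set (L * L * L) := [set p | exists m n, p = ((i m, i n), i (code m n))].
have fldG0 m : fld G0 (i m) by exists (i (code m m)), m, m.
have fldS (G G' : set (L * L * L)) : G `<=` G' -> fld G `<=` fld G'.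
  by move=> GG' x [y Gxy]; exists y; apply: GG'.
have [|||G [[Ginj Gfld Gtot] G0G maxG]] := @Zorn_above _ P G0.
- by exists ((i 0%N, i 0%N), i (code 0%N 0%N)), 0%N, 0%N.
- split=> [p q [m [n ->]] [m' [n' ->]] /=|p [m [n ->]] /=|x y [z [m [n]]] [-> _ _] [z' [m' [n']]] [-> _ _]].
  + split=> [[/i_inj -> /i_inj ->]|/i_inj /code_inj [-> ->]] //.
  + by split; apply: fldG0.
  + by exists (i (code m m')), m, m'.
- move=> F _ FP _ Ftot.
  have FU X : F X -> X `<=` \bigcup_(Y in F) Y by move=> FX x Xx; exists X.
  split=> [p q [X FX Xp] [Y FY Yq]|p [X FX Xp]|x y [z [X FX Xz]] [w [Y FY Yw]]].
  + have [/(_ _ Xp) Yp|/(_ _ Yq) Xq] := Ftot _ _ FX FY.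
      by have [+ _ _] := FP _ FY; apply.
    by have [+ _ _] := FP _ FX; apply.
  + have [_ /(_ p Xp) [] p11 p12 p2 _] := FP _ FX.
    by split; apply: (fldS _ _ (FU X FX)).
  + have [/(_ _ Xz) Yz|/(_ _ Yw) Xw] := Ftot _ _ FX FY.
      by have [_ _ /(_ x y)] := FP _ FY; case=> [||v Yv]; [exists z|exists w|exists v; exists Y].
    by have [_ _ /(_ x y)] := FP _ FX; case=> [||v Yv]; [exists z|exists w|exists v; exists X].
set X := fld G in Gfld Gtot.
have Xi n : X (i n) by apply: (fldS _ _ G0G).
have /choice [m' m'P] : forall p : L * L, exists z, X p.1 -> X p.2 -> G (p, z).
  move=> [x y] /=; have [[Xx Xy]|nX] := pselect (X x /\ X y).
    by have [z Gz] := Gtot _ _ Xx Xy; exists z.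
  by exists x => Xx Xy; case: nX.
pose m x y := m' (x, y).
have mP x y : X x -> X y -> G ((x, y), m x y) by move=> *; apply: m'P.
have mX x y : X x -> X y -> X (m x y) by move=> Xx Xy; case: (Gfld _ (mP _ _ Xx Xy)).
have m_inj x y x' y' : X x -> X y -> X x' -> X y' -> m x y = m x' y' -> x = x' /\ y = y'.
  move=> Xx Xy Xx' Xy' E.
  by have /(Ginj _ _ (mP _ _ Xx Xy) (mP _ _ Xx' Xy')) [-> ->] := E.
(* If the complement injects into [X], then so does [L], and the pairing on [X] codes [L * L]. If
   [X] injects into its complement, [G] can be enlarged, against maximality. *)
have [[j jX j_inj]|[j jX j_inj]] := set_comparable X (~` X); last first.
  pose c x := if pselect (X x) then m (i 0%N) x else m (i 1%N) (j x).
  have cX x : X (c x).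
    by rewrite /c; case: pselect => Xx; apply: mX => //; apply: jX.
  have c_inj : injective c.
    move=> x y; rewrite /c; case: pselect => Xx; case: pselect => Xy E;
      have [//|||| ] := m_inj _ _ _ _ _ _ _ _ E => //; try exact: jX.
    - by move=> /i_inj.
    - by move=> /i_inj.
    - by move=> _; apply: j_inj.
  exists (fun p => m (c p.1) (c p.2)) => -[x y] [x' y'] /= E.
  by have [//|//|//|//|/c_inj -> /c_inj ->] := m_inj _ _ _ _ _ _ _ _ E.
(* [Y] consists of two copies of [X]: each element has a root [r u] in [X] and a tag, so [cod] codes
   pairs from [Y] inside [X]. Pairs not in [X * X] receive the value [j (cod u v)], outside [X] and
   thus different from all old values. *)
pose Y := X `|` j @` X.
have jnX x : X x -> ~ X (j x) by move=> /jX.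
have /choice [r rP] : forall u, exists x, Y u -> X x /\ (u = x \/ u = j x).
  move=> u; have [[Xu|[x Xx <-]]|nY] := pselect (Y u).
  - by exists u => _; split => //; left.
  - by exists x => _; split => //; right.
  - by exists u.
pose tag u : nat := `[< X u >].
have r_inj u v : Y u -> Y v -> tag u = tag v -> r u = r v -> u = v.
  move=> /rP [Xru ru] /rP [Xrv rv] tuv ruv.
  have Xuv : X u <-> X v.
    by move: tuv; rewrite /tag; case: asboolP => Xu; case: asboolP => Xv.
  case: ru rv => ru [] rv.
  - by rewrite ru ruv -rv.
  - by case: (jnX _ Xrv); rewrite -rv; apply/Xuv; rewrite ru.
  - by case: (jnX _ Xru); rewrite -ru; apply/Xuv; rewrite rv.
  - by rewrite ru ruv -rv.
pose cod u v := m (i (code (tag u) (tag v))) (m (r u) (r v)).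
have codX u v : Y u -> Y v -> X (cod u v).
  by move=> /rP [? _] /rP [? _]; apply: (mX) => //; apply: (mX).
have cod_inj u v u' v' : Y u -> Y v -> Y u' -> Y v' -> cod u v = cod u' v' -> u = u' /\ v = v'.
  move=> Yu Yv Yu' Yv'; have [[Xu _] [Xv _]] := (rP _ Yu, rP _ Yv).
  have [[Xu' _] [Xv' _]] := (rP _ Yu', rP _ Yv').
  move=> /m_inj [||||/i_inj/code_inj [tu tv] /m_inj [//|//|//|//|ru rv]] //; try exact: mX.
  by split; apply: r_inj.
pose G' : set (L * L * L) := G `|` [set p | exists u v,
  [/\ Y u, Y v, ~ (X u /\ X v) & p = ((u, v), j (cod u v))]].
have GG' : G `<=` G' by move=> p Gp; left.
have YG' u v : Y u -> Y v -> exists z, G' ((u, v), z).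
  move=> Yu Yv; have [[Xu Xv]|nXuv] := pselect (X u /\ X v).
    by have [z Gz] := Gtot _ _ Xu Xv; exists z; left.
  by exists (j (cod u v)); right; exists u, v.
have YX u : Y u -> fld G' u by move=> Yu; apply: YG'.
have fldY u : fld G' u -> Y u.
  by move=> [y [/Gfld [/= Xu _ _]|[u' [v' [Yu' _ _ [-> _ _]]]]]] => //; left.
have PG' : P G'.
  split.
  - move=> p q [Gp|[u [v [Yu Yv nuv ->]]]] [Gq|[u' [v' [Yu' Yv' nuv' ->]]]] /=.
    + exact: Ginj.
    + have [Xp1 Xp2 Xp] := Gfld _ Gp; split=> E.
        by case: nuv'; rewrite E in Xp1 Xp2.
      by rewrite E in Xp; case: (jnX _ _ Xp); apply: codX.
    + have [Xp1 Xp2 Xp] := Gfld _ Gq; split=> E.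
        by case: nuv; rewrite -E in Xp1 Xp2.
      by rewrite -E in Xp; case: (jnX _ _ Xp); apply: codX.
    + split=> [[-> ->] //|/j_inj E].
      by have [-> ->] := cod_inj _ _ _ _ Yu Yv Yu' Yv' (E (codX _ _ Yu Yv) (codX _ _ Yu' Yv')).
  - move=> p [Gp|[u [v [Yu Yv nuv ->]]]] /=.
      by have [? ? ?] := Gfld _ Gp; split; apply: (fldS _ _ GG').
    by split; apply: YX => //; right; exists (cod u v) => //; apply: codX.
  - by move=> x y /fldY Yx /fldY Yy; apply: YG'.
case: (jnX _ (Xi 0%N)); apply: (fldS _ _ (maxG _ GG' PG')).
by apply: YX; right; exists (i 0%N).
Qed.

Lemma card_le_seq_self (L : Type) : card_le nat L -> card_le (seq L) L.
Proof.
move=> natL; have [p p_inj] := card_le_square natL; have [i _] := natL.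
apply: (@card_le_trans _ (nat * L)); last first.
  apply: card_le_trans (ex_intro _ p p_inj).
  by apply: card_le_prod => //; exists id.
(* Iterated pairing ends in the arbitrary value [i 0]; the length, stored separately, tells where to
   stop decoding. *)
pose code := foldr (fun x y => p (x, y)) (i 0%N).
exists (fun s => (size s, code s)); elim=> [|x s IH] [|y t] //= [st /p_inj [-> ct]].
by rewrite (IH t) // st ct.
Qed.

Lemma card_le_prod_self (A B L : Type) : card_le nat L -> card_le A L -> card_le B L ->
  card_le (A * B) L.
Proof. by move=> natL AL BL; apply: card_le_trans (card_le_square natL); apply: card_le_prod. Qed.

(** * A cardinal with more sequences than elements *)

Section Konig.
Variable B0 : Type.

(** Iterated power sets of [B0]. Their disjoint union is the supremum of a strictly increasing
    sequence of cardinals, so it has countable cofinality. *)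
Fixpoint iter_pow (n : nat) : Type := if n is m.+1 then iter_pow m -> bool else B0.

Lemma card_le_iter_pow n : card_le (iter_pow n) {n & iter_pow n}.
Proof.
exists (fun b => existT iter_pow n b) => x y.
by move=> /(congr1 (tagged_as (Tagged iter_pow x))); rewrite !tagged_asE.
Qed.

(** Let [s] invert [g]. For each [n], the values at [n] of the sequences coded in stage [n] do not
    fill the union, which contains the larger stage [n.+1]. A sequence [eta] avoiding these values
    at every [n] has no code. *)
Lemma konig : ~ card_le (nat -> {n & iter_pow n}) {n & iter_pow n}.
Proof.
move=> [g g_inj].
have /choice [s sg] : forall x : {n & iter_pow n}, exists f : nat -> {n & iter_pow n},
    forall f', g f' = x -> f' = f.
  move=> x; have [[f fx]|nf] := pselect (exists f, g f = x).
    by exists f => f' f'x; apply: g_inj; rewrite fx.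
  by exists (fun _ => x) => f' f'x; case: nf; exists f'.
have miss n : exists y : {n & iter_pow n}, forall b : iter_pow n, s (existT _ n b) n <> y.
  have [emb emb_inj] := card_le_iter_pow n.+1.
  (* Cantor's diagonal set: [b] is in it exactly when [b] is not in the set that
     [s (existT _ n b) n] stands for, if it stands for one. *)
  exists (emb (fun b => ~~ `[< exists2 d : iter_pow n.+1, emb d = s (existT _ n b) n & d b >])).
  move=> b; set d := (X in emb X) => E.
  have dE : d b = ~~ `[< exists2 d : iter_pow n.+1, emb d = s (existT _ n b) n & d b >] by [].
  have [db|ndb] := boolP (d b).
    by move: dE; rewrite db; case: asboolP => // -[]; exists d.
  move: dE; rewrite (negbTE ndb); case: asboolP => // -[d' d'E d'b] _.
  by move: ndb; rewrite -(emb_inj d' d) ?d'b // d'E E.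
have [eta etaP] := choice miss.
have := sg (g eta) eta erefl; case: (g eta) => m b E.
by apply: (etaP m b); rewrite -E.
Qed.

End Konig.

(** * Limit models over a noetherian ring *)

Lemma linear_ker_inj (R : nzRingType) (V W : lmodType R) (f : {linear V -> W}) :
  (forall x, f x = 0 -> x = 0) -> injective f.
Proof.
by move=> f0 x y fxy; apply/eqP; rewrite -subr_eq0; apply/eqP/f0; rewrite linearB /= fxy subrr.
Qed.

Lemma inj_surj_bijective (A B : Type) (f : A -> B) :
  injective f -> (forall b, exists a, f a = b) -> bijective f.
Proof. by move=> f_inj /choice [g fg]; exists g => // a; apply: f_inj; rewrite fg. Qed.

(** * Bumby's theorem for injective modules *)

Section Bumby.
Variables (R : nzRingType) (M N : lmodType R).
Hypothesis noethR : left_noetherian R.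
Hypotheses (bM : baer [set: M]) (bN : baer [set: N]).
Variables (f : {linear M -> N}) (g : {linear N -> M}).
Hypotheses (f0 : forall x, f x = 0 -> x = 0) (g0 : forall x, g x = 0 -> x = 0).

(* Write [h = g \o f], [M = P (+) g N] and [X = P + h P + h^2 P + ...]; as [R] is noetherian, [h X] is injective, so [g N = h X (+) Y], and [M = X (+) Y] is isomorphic to [h X (+) Y = g N]. *)
Theorem bumby : mod_iso M N.
Proof.
have g_inj := linear_ker_inj g0.
have bgN : baer (range g).
  by apply: (baer_image bN) => [|x _]; [exact: linear_on_linear|exact: g0].
have [p [pN pE]] := baer_projection bgN.
pose P := [set x | [set: M] x /\ p x = 0].
have bP : baer P by apply: (baer_kernel bM _ pN pE).
have [[P0 _ _] _] := bP.
pose h x := g (f x).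
have hl (S : set M) : linear_on S h.
  by split=> *; rewrite /h ?linearD ?linearZ.
have [hD hZ] := hl setT.
have h0 x : h x = 0 -> x = 0 by move=> /g0/f0.
have h00 : h 0 = 0 by rewrite /h !linear0.
have hN x : range g (h x) by exists (f x).
have PN x : P x -> range g x -> x = 0 by move=> [_ px] /pE <-.
(* [Xn n] is the sum of [P], [h P], ..., [h^(n-1) P]. *)
pose Xn := fix Xn n : set M := if n is m.+1
  then [set x | exists s t, [/\ P s, (h @` Xn m) t & x = s + t]] else [set 0].
have bXn n : baer (Xn n).
  elim: n => [|n IH].
    split; first by split=> //= [x y -> ->|r x ->]; rewrite ?addr0 ?scaler0.
    by move=> I phi _ _ phi0; exists 0 => // x /phi0 ->; rewrite scaler0.
  apply: baer_sum => //; first by apply: baer_image => // x _; apply: h0.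
  by move=> x Px [y _ yx]; apply: PN => //; rewrite -yx.
have XnS n : Xn n `<=` Xn n.+1.
  elim: n => [x /= ->|n IH x [s [t [Ps [y Xy <-] ->]]]].
    by exists 0, 0; split=> //; [exists 0|rewrite addr0].
  by exists s, (h y); split=> //; exists y => //; apply: IH.
have Xn_mono m n : (m <= n)%N -> Xn m `<=` Xn n.
  by move=> /subnKC <-; elim: (n - m)%N => [|k IH]; rewrite ?addn0 // addnS => x /IH /XnS.
pose X := \bigcup_(Y in range Xn) Y.
have bX : baer X.
  apply: noetherian_baer_bigcup => //.
  - by exists (Xn 0%N); exists 0%N.
  - by move=> _ _ [m _ <-] [n _ <-]; case: (leqP m n) => [|/ltnW] /Xn_mono; [left|right].
  - by move=> _ [n _ <-].
have XP s x : P s -> X x -> X (s + h x).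
  move=> Ps [_ [n _ <-] Xx]; exists (Xn n.+1); first by exists n.+1.
  by exists s, (h x); split=> //; exists x.
have Xinv x : X x -> exists s y, [/\ P s, X y & x = s + h y].
  move=> [_ [n _ <-]] /XnS [s [_ [Ps [y Xy <-] ->]]]; exists s, y; split=> //.
  by exists (Xn n) => //; exists n.
have bhX : baer (h @` X) by apply: baer_image => // x _; apply: h0.
have [q [qX qE]] := baer_projection bhX.
have hXN x : (h @` X) x -> range g x by move=> [y _ <-].
have [sN _] := bgN.
(* The element [m - p m + q (p m)] is the component of [m] in [X = P + h X], and [p m - q (p m)] the
   one in [Y]; [th] is [h] on [X] and the identity on [Y]. *)
pose th m := h (m - p m + q (p m)) + (p m - q (p m)).
have thN m : range g (th m).
  have [_ ND _] := sN; apply: ND => //; apply: (submB sN) => //.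
  exact: hXN.
have thD x y : th (x + y) = th x + th y.
  have uD : (x + y) - p (x + y) + q (p (x + y)) = (x - p x + q (p x)) + (y - p y + q (p y)).
    by rewrite !linearD /= (addrACA x y) [LHS]addrACA.
  have vD : p (x + y) - q (p (x + y)) = (p x - q (p x)) + (p y - q (p y)).
    by rewrite !linearD /= addrACA.
  by rewrite /th uD vD hD // addrACA.
have thZ r x : th (r *: x) = r *: th x.
  have uZ : r *: x - p (r *: x) + q (p (r *: x)) = r *: (x - p x + q (p x)).
    by rewrite !linearZ /= !scalerDr ?scalerN.
  have vZ : p (r *: x) - q (p (r *: x)) = r *: (p x - q (p x)).
    by rewrite !linearZ /= !scalerDr ?scalerN.
  by rewrite /th uZ vZ hZ // [RHS]scalerDr.
have thinj m : th m = 0 -> m = 0.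
  move=> thm; have /eqP := thm; rewrite /th addr_eq0 => /eqP hE.
  have qp0 : q (p m - q (p m)) = 0 by rewrite linearB /= (qE (q (p m))) // subrr.
  have x0 : h (m - p m + q (p m)) = 0.
    rewrite -[LHS]qE ?hE ?linearN /= ?qp0 ?oppr0 // -hE; exists (m - p m + q (p m)) => //.
    have [y Xy <-] := qX (p m); apply: XP => //.
    by split=> //; rewrite linearB /= (pE (p m)) // subrr.
  have y0 : p m - q (p m) = 0 by apply/oppr_inj; rewrite oppr0 -hE.
  have pq : q (p m) = p m by apply/esym/eqP; rewrite -subr_eq0 y0.
  by have /h0 := x0; rewrite pq subrK.
have thsurj y : range g y -> exists m, th m = y.
  (* With [q y = h x], the preimage of [y = h x + (y - q y)] is [x + (y - q y)]. *)
  move=> Ny; have [x Xx hx] := qX y; have [s [z [Ps Xz xE]]] := Xinv x Xx.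
  have hzX : (h @` X) (h z) by exists z.
  have pm : p (x + (y - q y)) = h z + (y - q y).
    rewrite linearD xE linearD /=; have [_ ->] := Ps; rewrite add0r (pE (h z)) //.
    by rewrite (pE (y - q y)) //; apply: (submB sN) => //; apply: hXN.
  have qpm : q (h z + (y - q y)) = h z.
    by rewrite linearD linearB /= (qE (h z)) // (qE (q y)) // subrr addr0.
  exists (x + (y - q y)); rewrite /th pm qpm xE opprD [in X in h X]addrACA.
  rewrite subrr addr0 -[s + h z - h z]addrA subrr addr0 -xE hx.
  by rewrite [h z + _]addrC addrK addrC subrK.
have /choice [k kE] : forall m, exists n, g n = th m.
  by move=> m; have [n _ nE] := thN m; exists n.
exists k; split.
  by split=> [x y _ _|r x _]; apply: g_inj; rewrite ?linearD ?linearZ /= !kE ?thD ?thZ.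
apply: inj_surj_bijective => [x y kxy|n].
  apply/eqP; rewrite -subr_eq0; apply/eqP/thinj.
  by rewrite thD -scaleN1r thZ scaleN1r -!kE kxy subrr.
have [|m mE] := thsurj (g n); first by exists n.
by exists m; apply: g_inj; rewrite kE.
Qed.

End Bumby.

Lemma card_eq_le (R : nzRingType) (V : lmodType R) (S : pred V) (L : Type) :
  card_le {x | x \in S} L -> card_le L {x | x \in S} -> card_eq S L.
Proof. exact: card_le_antisym. Qed.

Lemma card_eq_leP (R : nzRingType) (V : lmodType R) (S : pred V) (L : Type) :
  card_eq S L -> card_le {x | x \in S} L /\ card_le L {x | x \in S}.
Proof.
move=> [f [g fK gK]]; split; first by exists f; apply: can_inj fK.
by exists g; apply: can_inj gK.
Qed.

Lemma card_eq_enum (R : nzRingType) (V : lmodType R) (S : pred V) (L : Type) :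
  card_eq S L -> exists f : L -> V, forall x, x \in S -> exists l, f l = x.
Proof.
move=> [f [g fK gK]]; exists (fun l => val (g l)) => x Sx.
by exists (f (exist _ x Sx)); rewrite fK.
Qed.

Lemma card_predT (R : nzRingType) (V : lmodType R) (L : Type) :
  card_eq (@predT V) L <-> card_le V L /\ card_le L V.
Proof.
have toT : card_le V {x : V | x \in predT}.
  by exists (fun x => exist (fun x : V => x \in predT) x isT) => x y [].
have ofT : card_le {x : V | x \in predT} V by exists val; apply: val_inj.
split=> [/card_eq_leP [lT gT]|[lT gT]].
  by split; [apply: card_le_trans lT|apply: card_le_trans ofT].
by apply: card_eq_le; [apply: card_le_trans lT|apply: card_le_trans toT].
Qed.

(** * Size of limit models and universal steps in them *)

Section Chains.
Variables (R : nzRingType) (K : cls R) (L : Type).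
Hypothesis K_absP : forall (V : lmodType R) (S : pred V), K S -> absP S.

Lemma wellorder_succ (A : Type) (lt : A -> A -> Prop) : wellorder lt ->
  (forall i, exists j, lt i j) -> forall i, exists j, is_succ lt i j.
Proof.
move=> [_ [_ [lt_total lt_wf]]] nomax i; have [k] := nomax i.
elim: (lt_wf k) => {}k _ IH ik.
have [[m mk im]|nm] := pselect (exists2 m, lt m k & lt i m); first exact: IH im.
exists k; split=> // m im; have [mk|[<-|]] := lt_total m k; last by right.
  by case: nm; exists m.
by left.
Qed.

Lemma limit_model_card (M : lmodType R) : card_le nat L -> limit_model K L M -> card_le M L.
Proof.
move=> natL [A [lt [C [[_ _ _ AL] [CK _ _ CM _]]]]].
have /choice [e eP] i : exists f : L -> M, forall x, x \in C i -> exists l, f l = x.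
  by apply: card_eq_enum; have [_ []] := CK i.
apply: (card_le_trans _ (card_le_prod_self natL AL (ex_intro _ id (fun _ _ => id)))).
apply: (@card_le_surj _ _ (fun p => e p.1 p.2)) => x; have [i Cx] := CM x.
by have [l <-] := eP i x Cx; exists (i, l).
Qed.

Lemma limit_model_universal (M : lmodType R) : limit_model K L M ->
  exists C0 C1 C2 : pred M, [/\ K C0, K C1, K C2, universal K L C0 C1 & universal K L C1 C2].
Proof.
move=> [A [lt [C [[wo [i0 _] nomax _] [CK _ _ _ Cuniv]]]]].
have [i1 i01] := wellorder_succ wo nomax i0; have [i2 i12] := wellorder_succ wo nomax i1.
exists (C i0), (C i1), (C i2).
by split; try (by have [_ []] := CK i0); try (by have [_ []] := CK i1);
  try (by have [_ []] := CK i2); apply: Cuniv.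
Qed.

End Chains.

Lemma set_predT (T : Type) : [set x | x \in @predT T] = [set: T].
Proof. by apply/seteqP; split. Qed.

(** * Uniqueness of limit models *)

Section Uniqueness.
Variables (R : nzRingType) (K : cls R) (L : Type).
Hypotheses (noethR : left_noetherian R) (natL : card_le nat L).
Hypothesis KP : forall (V : lmodType R) (S : pred V), K S <-> baer [set x | x \in S].

Let K_absP (V : lmodType R) (S : pred V) : K S -> absP S.
Proof. by move=> /KP /inj_submodP /inj_submod_linj; apply: linj_absP. Qed.

Lemma limit_model_baer (M : lmodType R) : limit_model K L M -> baer [set: M].
Proof.
move=> [A [lt [C [[[_ [_ [lt_total _]]] [i0 _] _ _] [CK Cinc _ CM _]]]]].
have -> : [set: M] = \bigcup_(X in range (fun i => [set x | x \in C i])) X.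
  apply/seteqP; split=> x // _; have [i Cx] := CM x.
  by exists [set x | x \in C i] => //; exists i.
apply: noetherian_baer_bigcup => //.
- by exists [set x | x \in C i0]; exists i0.
- move=> _ _ [i _ <-] [j _ <-]; have [ij|[->|ji]] := lt_total i j.
  + by left=> x; have [+ _] := Cinc _ _ ij; apply.
  + by left.
  + by right=> x; have [+ _] := Cinc _ _ ji; apply.
- by move=> _ [i _ <-]; apply/KP; have [_ []] := CK i.
Qed.

(** [M1 * M2] is injective of size [L] and contains a copy of [C0] in its second factor.
    Universality of [C1] over [C0] embeds it into [C1], and with it the first factor [M1]. *)
Lemma limit_model_embed (M1 M2 : lmodType R) : limit_model K L M1 -> limit_model K L M2 ->
  exists f : {linear M1 -> M2}, forall x, f x = 0 -> x = 0.
Proof.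
move=> lM1 lM2; have [C0 [C1 [C2 [KC0 _ _ univ01 _]]]] := limit_model_universal lM2.
have [cC0 [_ [_ [_ univ]]]] := univ01.
have [cC0L LcC0] := card_eq_leP cC0.
have bM1 := limit_model_baer lM1; have bM2 := limit_model_baer lM2.
have LM2 : card_le L M2 by apply: card_le_trans LcC0 _; exists val; apply: val_inj.
have [|||h [[[[hD hZ] [_ h_inj]] _] _]] := univ (M1 * M2)%type (fun x => (0, x)).
- apply/KP; rewrite set_predT.
  by have := baer_prod bM1 bM2; rewrite setXTT.
- apply/card_predT; split.
    by apply: card_le_prod_self => //; apply: (limit_model_card (K := K)).
  by apply: (card_le_trans LM2); exists (fun x => (0, x)) => x y [].
- apply: absP_pure_emb; first exact: K_absP.
  split; first by split=> *; rewrite /= -?[RHS]/(_ + _, _ + _) -?[RHS]/(_ *: _, _ *: _) ?addr0 ?scaler0.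
  by split=> // x y _ _ [].
have [|f fE] := @pack_linear R M1 M2 (fun x => h (x, 0)).
  split=> [x y _ _|r x _]; [rewrite -hD //|rewrite -hZ //].
    by congr (h (_, _)); rewrite /= addr0.
  by congr (h (_, _)); rewrite /= scaler0.
exists f => x; rewrite fE => hx0.
have h0 : h 0 = 0 by rewrite -(scale0r 0) hZ // scale0r.
by have [] : (x, 0) = (0, 0) :> (M1 * M2)%type by apply: h_inj; rewrite // h0.
Qed.

Lemma limit_model_unique (M1 M2 : lmodType R) :
  limit_model K L M1 -> limit_model K L M2 -> mod_iso M1 M2.
Proof.
move=> lM1 lM2; have [f f0] := limit_model_embed lM1 lM2.
have [g g0] := limit_model_embed lM2 lM1.
by apply: (bumby noethR (limit_model_baer lM1) (limit_model_baer lM2) f0 g0).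
Qed.

End Uniqueness.

(** * Direct sums of copies of a module *)

Section FiniteSupport.
Variables (R : nzRingType) (J : choiceType) (E : lmodType R).

Definition finite_support : set (J -> E) :=
  [set f | exists s : seq J, forall p, f p <> 0 -> p \in s].

Lemma subm_finite_support : subm finite_support.
Proof.
split=> [|f g [s fs] [t gt]|r f [s fs]].
- by exists [::] => p [].
- exists (s ++ t) => p fgp; rewrite mem_cat.
  have [fp0|/fs -> //] := pselect (f p = 0).
  have [gp0|/gt -> //] := pselect (g p = 0); last by rewrite orbT.
  by case: fgp; rewrite -[LHS]/(f p + g p) fp0 gp0 addr0.
- by exists s => p fp; apply: fs => fp0; apply: fp; rewrite -[LHS]/(r *: f p) fp0 scaler0.
Qed.

Definition single (p : J) (x : E) : J -> E := fun q => if q == p then x else 0.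

Lemma single_finite_support p x : finite_support (single p x).
Proof. by exists [:: p] => q; rewrite /single inE; case: eqP. Qed.

Lemma singleD p x y : single p (x + y) = single p x + single p y.
Proof.
apply/funext => q; rewrite -[RHS]/(single p x q + single p y q) /single.
by case: eqP => _; rewrite ?addr0.
Qed.

Lemma singleZ p (r : R) x : single p (r *: x) = r *: single p x.
Proof.
apply/funext => q; rewrite -[RHS]/(r *: single p x q) /single.
by case: eqP => _; rewrite ?scaler0.
Qed.

Lemma finite_support_enum : exists enum : seq (J * E) -> J -> E,
  forall f, finite_support f -> exists t, enum t = f.
Proof.
exists (fun t p => xget 0 [set x | (p, x) \in t]) => f [s fs].
exists [seq (p, f p) | p <- s]; apply/funext => p.
case: xgetP => [x _ /mapP [q _ [-> ->]] //|nx].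
apply: contrapT => fp; apply: (nx (f p)).
by apply/mapP; exists p => //; apply: fs => fp0; apply: fp.
Qed.

End FiniteSupport.

(** * Existence of limit models *)

Section Existence.
Variables (R : nzRingType) (K : cls R) (L : Type).
Hypothesis noethR : left_noetherian R.
Hypothesis KP : forall (V : lmodType R) (S : pred V), K S <-> baer [set x | x \in S].
(** By [charmod_embed], every injective submodule whose elements are all named by terms, as those
    generated by a single element are, embeds in this [E]. *)
Let E : lmodType R := charmod R (term R).
Let J : choiceType := (nat * {classic L})%type.
Hypotheses (natL : card_le nat L) (EL : card_le E L).
Variables (M : lmodType R) (iota : {linear M -> (J -> E)}).
Hypotheses (iota_inj : injective iota) (iota_range : range iota = @finite_support R J E).

Let bE : baer [set: E]. Proof. exact: baer_charmod. Qed.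

Let K_absP (V : lmodType R) (S : pred V) : K S -> absP S.
Proof. by move=> /KP /inj_submodP /inj_submod_linj; apply: linj_absP. Qed.

Definition level (n : nat) : pred M :=
  fun m => `[< forall p : J, iota m p <> 0 -> (p.1 <= n)%N >].

Lemma levelP n m : reflect (forall p : J, iota m p <> 0 -> (p.1 <= n)%N) (m \in level n).
Proof. exact: asboolP. Qed.

Lemma subm_level n : subm [set m | m \in level n].
Proof.
split=> [|x y /levelP xn /levelP yn|r x /levelP xn]; apply/levelP => p.
- by rewrite linear0 => -[].
- rewrite linearD -[X in X <> _]/(iota x p + iota y p) => xy0.
  have [x0|/xn //] := pselect (iota x p = 0).
  by apply: yn => y0; apply: xy0; rewrite x0 y0 addr0.
- rewrite linearZ -[X in X <> _]/(r *: iota x p) => rx0.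
  by apply: xn => x0; apply: rx0; rewrite x0 scaler0.
Qed.

(** The equations are solved coordinate by coordinate, with 0 wherever all [phi (g j)] vanish. As
    the generators are finitely many, the solution has finite support and stays in the level. *)
Lemma baer_level n : baer [set m | m \in level n].
Proof.
apply: (noetherian_baer noethR (subm_level n)) => I phi k g sI [phiD phiZ] phiL gI _.
have [_ bE'] := bE.
have /choice [e eP] : forall p, exists x, (forall j, iota (phi (g j)) p = g j *: x) /\
    ((forall j, iota (phi (g j)) p = 0) -> x = 0).
  move=> p; have [all0|nall0] := pselect (forall j, iota (phi (g j)) p = 0).
    by exists 0; split=> // j; rewrite scaler0.
  have [||x _ xE] := bE' I (fun r => iota (phi r) p) sI => //.
    by split=> [x y Ix Iy|r x Ix]; rewrite ?phiD ?phiZ // (linearD, linearZ).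
  by exists x; split=> // j; apply/xE/gI.
have e_support p : e p <> 0 -> exists j, iota (phi (g j)) p <> 0.
  move=> ep; apply: contrapT => /forallNP all0; apply: ep; apply: (eP p).2 => j.
  by apply: contrapT; apply: all0.
have [m _ mE] : range iota e.
  rewrite iota_range.
  have /choice [s sP] j : exists s : seq J, forall p, iota (phi (g j)) p <> 0 -> p \in s.
    by have : range iota (iota (phi (g j))) by []; rewrite iota_range.
  exists (flatten [seq s j | j <- enum 'I_k]) => p /e_support [j /sP pj].
  by apply/flattenP; exists (s j) => //; apply/mapP; exists j; rewrite // mem_enum.
exists m; last by move=> j; apply: iota_inj; apply/funext => p; rewrite linearZ mE (eP p).1.
apply/levelP => p; rewrite mE => /e_support [j].
by have /levelP := phiL _ (gI j); apply.
Qed.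

Lemma delta_lin (p : J) : exists d : {linear E -> M}, forall x, iota (d x) = single p x.
Proof.
have /choice [d dE] : forall x, exists m, iota m = single p x.
  move=> x; have : range iota (single p x).
    by rewrite iota_range; apply: single_finite_support.
  by move=> [m _ <-]; exists m.
have [|d' d'E] := @pack_linear R E M d.
  split=> [x y _ _|r x _]; apply: iota_inj; rewrite ?linearD ?linearZ /= !dE.
    exact: singleD.
  exact: singleZ.
by exists d' => x; rewrite d'E.
Qed.

Lemma card_module : card_le M L.
Proof.
have JL : card_le J L by apply: card_le_prod_self => //; exists id.
apply: card_le_trans (card_le_seq_self natL).
apply: card_le_trans (card_le_seq (card_le_prod_self natL JL EL)).
have [enum enumP] := @finite_support_enum R J E.
have /choice [c cE] : forall m, exists t, enum t = iota m.
  by move=> m; apply: enumP; rewrite -iota_range.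
by exists c => x y cxy; apply: iota_inj; rewrite -!cE cxy.
Qed.

Lemma card_level n : card_eq (level n) L.
Proof.
apply: card_eq_le.
  by apply: card_le_trans card_module; exists val; apply: val_inj.
(* [f 1] is a nonzero element of [E]; placed in the coordinates [(0, l)], it gives [L] different
   elements of the level. *)
have [f f1] := @charmod_embed R (term R) R^o (fun _ => 1).
have e0 : f 1 <> 0.
  by move=> /(f1 (Gen R 0)) /eqP; rewrite oner_eq0.
have /choice [d dE] : forall l : {classic L}, exists m, iota m = single (0%N, l) (f 1 : E).
  by move=> l; have [d dE] := delta_lin (0%N, l); exists (d (f 1)).
have dL l : d l \in level n.
  by apply/levelP => p; rewrite dE /single; case: eqP => // ->.
exists (fun l => exist _ (d l) (dL l)) => l l' [/(congr1 iota)]; rewrite !dE.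
move=> /(congr1 (fun h => h (0%N, l))); rewrite /single eqxx.
by case: eqP => // -[].
Qed.

Lemma level_sub m n : (m <= n)%N -> {subset level m <= level n}.
Proof. by move=> mn x /levelP xm; apply/levelP => p /xm /leq_trans; apply. Qed.

Lemma level_pure m n : (m <= n)%N -> pure_emb (level m) (level n) id.
Proof.
move=> mn; apply: absP_pure_emb; first by apply/K_absP/KP/baer_level.
by split=> //; split=> // x; apply: level_sub.
Qed.

(* Zorn over the partial embeddings of [W] extending [g^-1]: as [R] is noetherian, a domain [D] is a summand, and an element of the complement lies in an injective submodule [S] that is small, i.e. embeds in [E]. The coordinate reserved for [S] is indexed by an element of [S], hence is not used on [D]. *)
Lemma level_universal n (W : lmodType R) (g : M -> W) (e : W -> L) :
  baer [set: W] -> injective e -> emb (level n) (@predT W) g ->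
  exists h : {linear W -> M},
    [/\ forall w, h w = 0 -> w = 0, forall w, h w \in level n.+1
      & forall x, x \in level n -> h (g x) = x].
Proof.
move=> bW e_inj [[gD gZ] [_ g_inj]].
have sL := subm_level n; have [L0 LD LZ] := sL.
have [LS0 LSD LSZ] := subm_level n.+1.
have g0 : g 0 = 0 by apply: (linear_on0 sL); split.
pose dom (G : set (W * M)) : set W := [set w | exists m, G (w, m)].
pose P (G : set (W * M)) := [/\ subm G,
  (forall m, G (0, m) -> m = 0) /\ (forall w, G (w, 0) -> w = 0),
  baer (dom G), (forall p, G p -> p.2 \in level n.+1)
  & forall p l, G p -> iota p.2 (n.+1, l) <> 0 -> exists w, dom G w /\ e w = l].
pose G0 : set (W * M) := [set p | p.2 \in level n /\ p.1 = g p.2].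
have [|||G [[sG [Gf Gi] bG GL Gl] G0G maxG]] := @Zorn_above _ P G0.
- by exists 0; split.
- split.
  + split=> [//|[w x] [w' x'] [/= Lx ->] [/= Lx' ->]|r [w x] [/= Lx ->]].
      by split; [apply: LD|rewrite /= gD].
    by split; [apply: LZ|rewrite /= gZ].
  + split=> [m [/= Lm gm]|w [_ /= ->]] //.
    by apply: g_inj; rewrite // g0.
  + rewrite (_ : dom G0 = g @` [set x | x \in level n]).
      apply: baer_image; first exact: baer_level.
        by split.
      by move=> x Lx gx; apply: g_inj; rewrite // g0.
    by apply/seteqP; split=> [w [x [/= Lx ->]]|_ [x Lx <-]]; exists x.
  + by move=> [w x] [/= Lx _]; apply: level_sub Lx.
  + by move=> [w x] l [/= /levelP Lx _] /Lx /=; rewrite ltnn.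
- move=> F F0 FP _ Ftot.
  have FU X : F X -> X `<=` \bigcup_(Y in F) Y by move=> FX x Xx; exists X.
  have domS (X Y : set (W * M)) : X `<=` Y -> dom X `<=` dom Y.
    by move=> XY w [m Xm]; exists m; apply: XY.
  split.
  + by apply: subm_chain => // X /FP [].
  + by split=> [m|w] [X /FP [_ [X1 X2] _ _ _]]; [apply: X1|apply: X2].
  + rewrite (_ : dom _ = \bigcup_(Y in dom @` F) Y).
      apply: noetherian_baer_bigcup => //.
      * by have [X FX] := F0; exists (dom X); exists X.
      * by move=> _ _ [X FX <-] [Y FY <-]; have [XY|YX] := Ftot _ _ FX FY;
          [left|right]; apply: domS.
      * by move=> _ [X /FP [_ _ ? _ _] <-].
    apply/seteqP; split=> [w [m [X FX Xwm]]|w [_ [X FX <-] [m Xwm]]].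
      by exists (dom X); [exists X|exists m].
    by exists m; exists X.
  + by move=> p [X /FP [_ _ _ XL _]]; apply: XL.
  + move=> p l [X FX Xp] pl; have [_ _ _ _ /(_ p l Xp pl) [w [Xw ew]]] := FP _ FX.
    by exists w; split=> //; apply: domS Xw; apply: FU.
have [sD _] := bG; have [D0 DD DZ] := sD; have [G00 GD GZ] := sG.
have domG : dom G = [set: W].
  apply/seteqP; split=> // w0 _; apply: contrapT => nDw0.
  have [p [pD pE]] := baer_projection bG.
  pose Q := [set x | [set: W] x /\ p x = 0].
  have bQ : baer Q by apply: (baer_kernel bW _ pD pE).
  pose w1 := w0 - p w0.
  have Qw1 : Q w1 by split; rewrite // /w1 linearB /= (pE (p w0)) // subrr.
  have nDw1 : ~ dom G w1.
    by move=> Dw1; apply: nDw0; rewrite -[w0](subrK (p w0)); apply: DD.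
  (* Taken inside the complement [Q], the injective submodule [S] generated by [w1] meets the domain
     in 0 only; its elements are named by terms, so [f] embeds it in [E]. *)
  pose tau := interp Q (fun _ => w1).
  pose S := range tau.
  have bS : baer S by apply: baer_interp.
  have SQ x : S x -> p x = 0.
    by move=> [t _ <-]; have [] : Q (tau t) by apply: interp_in.
  have Sw1 : S w1 by exists (Gen R 0).
  have [f f0] := charmod_embed tau.
  have {}f0 x : S x -> f x = 0 -> x = 0 by move=> [t _ <-]; apply: f0.
  have [d dE] := delta_lin (n.+1, e w1).
  have dL x : d x \in level n.+1.
    by apply/levelP => q; rewrite dE /single; case: eqP => // ->.
  have DS0 x : dom G x -> S x -> x = 0 by move=> Dx /SQ <-; rewrite pE.
  have [[S0 SD SZ] _] := bS.
  pose G' : set (W * M) := [set q | exists w m s, [/\ G (w, m), S s & q = (w + s, m + d (f s))]].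
  have GG' : G `<=` G'.
    by move=> [w m] Gwm; exists w, m, 0; rewrite !linear0 !addr0.
  have domG' w s : dom G w -> S s -> dom G' (w + s).
    by move=> [m Gwm] Ss; exists (m + d (f s)); exists w, m, s.
  have domG'w1 : dom G' w1.
    by rewrite -[w1]add0r; apply: domG'; [exact: D0|exact: Sw1].
  apply: (nDw1); have [m Gm] := domG'w1; exists m; move: Gm; apply: (maxG _ GG').
  have iotaD q r x : iota (q + r) x = iota q x + iota r x by rewrite linearD.
  split.
  + split; first by apply: GG'.
      move=> _ _ [w [x [s [Gwx Ss ->]]]] [w' [x' [s' [Gwx' Ss' ->]]]].
      exists (w + w'), (x + x'), (s + s'); split; [exact: (GD _ _ Gwx Gwx')|exact: SD|].
      by rewrite !linearD; congr (_, _); rewrite /= addrACA.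
    move=> r _ [w [x [s [Gwx Ss ->]]]].
    exists (r *: w), (r *: x), (r *: s); split; [exact: (GZ r _ Gwx)|exact: SZ|].
    by rewrite !linearZ /=; congr (_, _); rewrite /= scalerDr.
  + split=> [_ [w [x [s [Gwx Ss [/esym/eqP ws ->]]]]]|_ [w [x [s [Gwx Ss [-> /esym xs]]]]]].
      move: ws; rewrite addr_eq0 => /eqP ws.
      have w0' : w = 0.
        by apply: DS0; [exists x|rewrite ws; apply: submN => //; case: bS].
      have s0 : s = 0 by apply/oppr_inj; rewrite -ws w0' oppr0.
      by rewrite s0 !linear0 addr0; apply: Gf; rewrite -w0'.
    (* A nonzero coordinate of [x] at [(n.+1, e w1)] would put [w1] in the domain. So this
       coordinate of [x + d (f s)] is [f s]. *)
    have fs0 : f s = 0.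
      have := congr1 (fun q => iota q (n.+1, e w1)) xs.
      rewrite linear0 -[X in _ = X -> _]/(0 : E) iotaD dE /single eqxx.
      suff -> : iota x (n.+1, e w1) = 0 by rewrite add0r.
      apply: contrapT => xl; have [w' [Dw' /e_inj E']] := Gl _ _ Gwx xl.
      by apply: nDw1; rewrite -E'.
    have s0 := f0 _ Ss fs0; move: xs; rewrite fs0 linear0 addr0 => x0.
    by rewrite s0 addr0; apply: Gi; rewrite -x0.
  + rewrite (_ : dom G' = [set x | exists w s, [/\ dom G w, S s & x = w + s]]).
      exact: baer_sum.
    apply/seteqP; split=> [_ [_ [w [x [s [Gwx Ss [-> _]]]]]]|_ [w [s [Dw Ss ->]]]].
      by exists w, s; split=> //; exists x.
    exact: domG'.
  + by move=> _ [w [x [s [Gwx Ss ->]]]]; apply: LSD; [exact: (GL _ Gwx)|exact: dL].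
  + move=> _ l [w [x [s [Gwx Ss ->]]]] /=; rewrite iotaD dE /single.
    have [x0|/(Gl _ _ Gwx) [w' [[y Gy] <-]] _] := pselect (iota x (n.+1, l) = 0); last first.
      by exists w'; split=> //; exists y; apply: GG'.
    rewrite x0 add0r; case: eqP => [[->] _|//].
    by exists w1.
have tot w : exists m, G (w, m) by have : dom G w by rewrite domG.
have /choice [h hP] := tot.
have [|h' h'E] := @pack_linear R W M h.
  split=> [x y _ _|r x _]; apply: (graph_fun sG Gf (hP _)).
    exact: (GD _ _ (hP x) (hP y)).
  exact: (GZ r _ (hP x)).
exists h'; split=> [w|w|x Lx]; rewrite h'E.
- by move=> hw; apply: Gi; rewrite -hw.
- exact: (GL _ (hP w)).
- by apply: (graph_fun sG Gf (hP _)); apply: G0G.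
Qed.

Lemma limit_model_finite_support : limit_model K L M.
Proof.
exists nat, (fun m n => (m < n)%N), level; split; split.
- split; first by move=> n; rewrite ltnn.
  split; first by move=> m n k; apply: ltn_trans.
  split; last by elim/ltn_ind => n IH; constructor.
  by move=> m n; case: (ltngtP m n) => [| |->]; [left|right; right|right; left].
- by exists 0%N.
- by move=> n; exists n.+1.
- exact: natL.
- by move=> n; split; [apply/submodP/subm_level|split; [apply/KP/baer_level|apply: card_level]].
- by move=> m n /ltnW mn; split; [apply: level_sub|apply: level_pure].
(* Continuity is vacuous: no natural number is a limit. *)
- move=> [[[j]] //|n [_ /(_ n (ltnSn n)) [k [nk kn]]]].
  by move: kn; rewrite ltnNge nk.
- move=> m; have : range iota (iota m) by [].
  rewrite iota_range => -[s ms]; exists (\max_(p <- s) p.1).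
  by apply/levelP => p /ms ps; rewrite (big_rem p) //= leq_maxl.
- move=> m n [mn /(_ m.+1 (ltnSn m)) nm].
  have {nm mn} -> : n = m.+1 by case: nm mn => [->//|nm mn]; apply/eqP; rewrite eqn_leq mn andbT ltnW.
  split; first exact: card_level.
  split; first exact: card_level.
  split; first exact: level_sub.
  split; first exact: level_pure.
  move=> W g KW /card_predT [[e e_inj] _] [eg _].
  have bW : baer [set: W] by rewrite -set_predT; apply/KP.
  have [h [h0 hL hg]] := level_universal bW e_inj eg.
  exists h; split=> //; apply: absP_pure_emb; first exact: K_absP.
  split; first by split=> *; rewrite ?linearD ?linearZ.
  by split=> // x y _ _; apply: linear_ker_inj.
Qed.

End Existence.

Lemma noetherian_superstable (R : nzRingType) (K : cls R) : left_noetherian R ->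
  (forall (V : lmodType R) (S : pred V), K V S <-> baer [set x | x \in S]) -> superstable K.
Proof.
move=> noethR KP; exists (charmod R (term R) + nat)%type => L muL.
have EL : card_le (charmod R (term R)) L by apply: card_le_trans muL; exists inl => x y [].
have natL : card_le nat L by apply: card_le_trans muL; exists inr => x y [].
split; last by move=> M1 M2; apply: limit_model_unique.
have [M [iota [iota_inj iota_range]]] := submodule_lmod
  (@subm_finite_support R (nat * {classic L})%type (charmod R (term R))).
by exists M; apply: (limit_model_finite_support noethR KP natL EL iota_inj iota_range).
Qed.

(** * Superstability implies noetherian *)

Section AscendingChain.
Variable R : nzRingType.

Definition left_span (s : seq R) : set R^o :=
  [set x | exists c : 'I_(size s) -> R, x = \sum_(j < size s) c j * s`_j].

Lemma subm_left_span s : subm (left_span s).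
Proof.
split=> [|x y [c ->] [d ->]|r x [c ->]].
- by exists (fun _ => 0); rewrite big1 // => j _; rewrite mul0r.
- exists (fun j => c j + d j); rewrite -big_split; apply: eq_bigr => j _.
  by rewrite mulrDl.
- exists (fun j => r * c j); rewrite scaler_sumr; apply: eq_bigr => j _.
  by rewrite -mulrA.
Qed.

Lemma left_span_min s (J : set R^o) : subm J -> (forall x, x \in s -> J x) -> left_span s `<=` J.
Proof.
move=> [J0 JD JZ] Js x [c ->]; elim/big_ind: _ => [|y z|j _]; [exact: J0|exact: JD|].
by apply: (JZ (c j)); apply/Js/mem_nth.
Qed.

Lemma mem_left_span s x : x \in s -> left_span s x.
Proof.
move=> xs; have xi : (index x s < size s)%N by rewrite index_mem.
exists (fun j => (j == Ordinal xi)%:R); rewrite (bigD1 (Ordinal xi)) //= eqxx mul1r nth_index //.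
by rewrite big1 ?addr0 // => i /negPf ->; rewrite mul0r.
Qed.

(** In a left ideal that is not finitely generated, an element outside the span of those chosen so
    far can always be chosen next; [I n] is the span of the first [n], and [r n] is the following
    one. *)
Lemma ascending_chain : ~ left_noetherian R ->
  exists (I : nat -> set R^o) (r : nat -> R), [/\ forall n, subm (I n),
    forall n, I n `<=` I n.+1, forall n, I n.+1 (r n) & forall n, ~ I n (r n)].
Proof.
move=> nnoeth.
have [I [idI nfg]] : exists I : pred R, left_ideal I /\ forall s : seq R,
    (forall x, x \in s -> x \in I) -> exists x, x \in I /\ ~ left_span s x.
  apply: contrapT => /forallNP nI; apply: nnoeth => I idI; apply: contrapT => nfg.
  apply: (nI I); split=> // s sI; apply: contrapT => /forallNP nx; apply: nfg.
  exists (size s), (fun j => s`_j) => x; split=> [Ix|].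
    have [c xE] : left_span s x by apply: contrapT => nsx; apply: (nx x).
    by exists c.
  have [I0 [ID IZ]] := idI.
  move=> xs; have /left_span_min : @subm R R^o [set x | x \in I] by split.
  by move=> /(_ s sI x xs).
have /choice [next nextP] : forall s : seq R, exists x, (forall y, y \in s -> y \in I) ->
    x \in I /\ ~ left_span s x.
  move=> s; have [/nfg [x xP]|nsI] := pselect (forall y, y \in s -> y \in I); first by exists x.
  by exists 0.
pose s n := iter n (fun s => rcons s (next s)) [::].
have sI n : forall y, y \in s n -> y \in I.
  elim: n => [//|n IH] y; rewrite /= mem_rcons inE => /orP[/eqP ->|/IH //].
  by have [] := nextP _ IH.
exists (fun n => left_span (s n)), (fun n => next (s n)); split=> n.
- exact: subm_left_span.
- apply: left_span_min; first exact: subm_left_span.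
  by move=> x xs; apply: mem_left_span; rewrite /= mem_rcons inE xs orbT.
- by apply: mem_left_span; rewrite /= mem_rcons inE eqxx.
- by have [] := nextP _ (sI n).
Qed.

End AscendingChain.

Lemma linj_transport (R : nzRingType) (U W : lmodType R) (S : pred W) (iota : {linear U -> W}) :
  injective iota -> range iota = [set x | x \in S] -> linj S -> linj (@predT U).
Proof.
move=> iota_inj iotaS [_ lS]; split=> // n a _.
have iS u : iota u \in S.
  by have : [set x | x \in S] (iota u) by rewrite -iotaS; exists u.
have [T [/inj_submodP bT [TS aT]]] := lS n (fun j => iota (a j)) (fun j => iS _).
have /choice [q qE] w : exists u, w \in S -> iota u = w.
  have [wS|nS] := pselect (w \in S); last by exists 0.
  have : [set x | x \in S] w by [].
  by rewrite -iotaS => -[u _ <-]; exists u.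
have [[T0 TD TZ] _] := bT.
pose T' := q @` [set x | x \in T].
have qi u : q (iota u) = u by apply: iota_inj; apply: qE.
have bT' : baer T'.
  apply: baer_image => //.
    split=> [x y Tx Ty|r x Tx]; apply: iota_inj; rewrite ?linearD ?linearZ /= !qE //; try exact: TS.
      by apply/TS/TD.
    by apply/TS/TZ.
  by move=> x Tx qx; rewrite -(qE x) ?qx ?linear0 //; apply: TS.
exists (fun u => `[< T' u >]); split.
  apply/inj_submodP; rewrite (_ : [set _ | _] = T') //.
  by apply/seteqP; split=> u; [move=> /asboolP|move=> ?; apply/asboolP].
split=> // j; apply/asboolP; exists (iota (a j)); rewrite ?qi //; exact: aT.
Qed.

Section Converse.
Variables (R : nzRingType) (K : cls R).
Hypothesis linj_K : forall (V : lmodType R) (S : pred V), linj S -> K S.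
Hypothesis K_absP : forall (V : lmodType R) (S : pred V), K S -> absP S.

(** Any [L] elements of an injective extension [W] of [M] can be copied into [C'] over [C]. As [W]
    may be too large for universality, it is replaced by a locally injective hull of size [L] of
    these elements and [f C]. *)
Lemma universal_extension (L J : Type) (M W : lmodType R) (C C' : pred M)
    (f : {linear M -> W}) (X : J -> W) :
  card_le nat L -> card_le (term R) L -> card_le J L ->
  K C -> universal K L C C' -> baer [set: W] -> (forall x, f x = 0 -> x = 0) ->
  exists (S : set W) (h : W -> M),
    [/\ subm S, forall j, S (X j) & forall c, c \in C -> S (f c)] /\
    [/\ linear_on S h, forall w, S w -> h w = 0 -> w = 0, forall w, S w -> h w \in C'
      & forall c, c \in C -> h (f c) = c].
Proof.
move=> natL termL JL KC univ bW f0.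
have [cC [_ [_ [_ {}univ]]]] := univ; have [_ LC] := card_eq_leP cC.
have [eC eCP] := card_eq_enum cC; have f_inj := linear_ker_inj f0.
have [S [lS SX [enum enumP]]] := linj_hull
  (fun jl : J + L => match jl with inl j => X j | inr l => f (eC l) end) bW.
have SfC c : c \in C -> f c \in S by move=> /eCP [l <-]; apply: (SX (inr l)).
have [sS _] := lS; have sS' := (submodP S).1 sS; have [S0 SD SZ] := sS'.
have [U [iota [iota_inj iotaS]]] := submodule_lmod sS'.
have iS u : iota u \in S.
  by have : [set x | x \in S] (iota u) by rewrite -iotaS; exists u.
have /choice [q qE] w : exists u, w \in S -> iota u = w.
  have [wS|nS] := pselect (w \in S); last by exists 0.
  have : [set x | x \in S] w by [].
  by rewrite -iotaS => -[u _ <-]; exists u.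
have UL : card_le U L.
  have /choice [c cE] u : exists p, enum p = iota u by apply: enumP.
  apply: (@card_le_trans _ (seq (J + L) * term R)).
    by exists c => u v cuv; apply: iota_inj; rewrite -!cE cuv.
  apply: card_le_prod_self => //; apply: card_le_trans (card_le_seq_self natL).
  apply: card_le_seq; have [jl jl_inj] := JL; have [i i_inj] := natL.
  apply: card_le_trans (card_le_square natL).
  exists (fun x => match x with inl j => (i 0%N, jl j) | inr l => (i 1%N, l) end).
  by move=> [j|l] [j'|l'] [] // => [/jl_inj -> //|/i_inj|/i_inj|->].
have LU : card_le L U.
  apply: card_le_trans LC _; exists (fun c => q (f (val c))) => c d.
  move=> /(congr1 iota); rewrite !qE ?SfC ?(valP c) ?(valP d) //.
  by move=> /f_inj /val_inj.
have [|||h [[[[hD hZ] [hC' h_inj]] _] hE]] := univ U (fun c => q (f c)).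
- exact/linj_K/(linj_transport iota_inj iotaS).
- exact/card_predT.
- apply: absP_pure_emb; first exact: K_absP.
  split.
    split=> [x y Cx Cy|r x Cx]; apply: iota_inj; rewrite ?linearD ?linearZ /= !qE ?SfC ?linearD ?linearZ //.
      by apply: SD; apply: SfC.
    by apply: SZ; apply: SfC.
  by split=> // x y Cx Cy /(congr1 iota); rewrite !qE ?SfC // => /f_inj.
have h0 : h 0 = 0 by rewrite -(scale0r 0) hZ // scale0r.
exists [set w | w \in S], (h \o q); split; split=> //.
- by move=> j; apply: (SX (inl j)).
- split=> [x y Sx Sy|r x Sx] /=; [rewrite -hD //|rewrite -hZ //]; congr h; apply: iota_inj;
    rewrite ?linearD ?linearZ /= !qE //.
    exact: SD.
  exact: SZ.
- by move=> w Sw /= hw; rewrite -(qE w) // (_ : q w = 0) ?linear0 //; apply: h_inj; rewrite // h0.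
- by move=> w _; apply: hC'.
Qed.

Lemma superstable_noetherian : superstable K -> left_noetherian R.
Proof.
move=> [mu muP]; apply: contrapT => /ascending_chain [I [r [sI ISn Ir nIr]]].
(* [L] bounds [mu], the terms and [nat], but by [konig] it has fewer elements than sequences of
   elements. *)
pose B0 := (mu + term R + nat)%type; pose L := {n & iter_pow B0 n}.
have B0L : card_le B0 L by apply: (card_le_iter_pow B0 0).
have muL : card_le mu L by apply: card_le_trans B0L; exists (fun x => inl (inl x)) => x y [].
have termL : card_le (term R) L by apply: card_le_trans B0L; exists (fun x => inl (inr x)) => x y [].
have natL : card_le nat L by apply: card_le_trans B0L; exists inr => x y [].
have [[M limM] _] := muP L muL.
have [C0 [C1 [C2 [KC0 KC1 _ univ01 univ12]]]] := limit_model_universal limM.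
have Imono m n : (m <= n)%N -> I m `<=` I n.
  by move=> /subnKC <-; elim: (n - m)%N => [|k IH]; rewrite ?addn0 // addnS => x /IH /ISn.
pose Iinf : set R^o := \bigcup_(J in range I) J.
have Iinfn n x : I n x -> Iinf x by exists (I n) => //; exists n.
have sIinf : subm Iinf.
  apply: subm_chain => [|_ [n _ <-] //|_ _ [m _ <-] [n _ <-]]; first by exists (I 0%N), 0%N.
  by case: (leqP m n) => [|/ltnW] /Imono; [left|right].
have /choice [x xP] n : exists e : charmod R unit, (forall i : R, I n i -> i *: e = 0) /\ r n *: e <> 0.
  exact: ideal_separation.
pose J : choiceType := (nat * {classic L})%type.
(* The full product, not the direct sum: the elements [Phi eta] below have infinite support. *)
pose F : lmodType R := (J -> charmod R unit)%type.
have [W1 [i1 [bW1 i10]]] := enough_injectives (M * F)%type.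
have [|f1 f1E] := @pack_linear R M W1 (fun m => i1 (m, 0)).
  split=> [y z _ _|s y _]; rewrite -(linearD, linearZ); congr (i1 (_, _)).
    by rewrite /= addr0.
  by rewrite /= scaler0.
have [|S1 [h1 [[sS1 S1X _] [h1l h10 h1C1 _]]]] := universal_extension
  (fun p : J => i1 (0, single p (x p.1)) : W1) natL termL
  (card_le_prod_self natL natL (ex_intro _ id (fun _ _ => id))) KC0 univ01 bW1
  (f := f1).
  by move=> m; rewrite f1E => /i10 [].
pose Phi (eta : nat -> L) : F := fun p => if p.2 == eta p.1 then x p.1 else 0.
(* [S1] contains the single elements [x n] placed at [(n, l)], but perhaps not the infinite
   [Phi eta]. If [s] lies in [I N], it kills [x k] for all [k >= N], so [s *: Phi eta] is a multiple
   of the finite sum [PhiN N]. *)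
have S1Phi eta s : Iinf s -> S1 (i1 (0, s *: Phi eta)).
  move=> [_ [N _ <-] Is]; have [S10 S1D S1Z] := sS1.
  pose PhiN n : F := fun p => if (p.1 < n)%N then Phi eta p else 0.
  have S1PhiN n : S1 (i1 (0, PhiN n)).
    elim: n => [|n IH]; first by rewrite (_ : PhiN 0%N = 0) // linear0.
    have -> : (0, PhiN n.+1) = (0, PhiN n) + (0, single (n, eta n : {classic L}) (x n)) :> M * F.
      congr (_, _); first by rewrite /= addr0.
      apply/funext => -[k l]; rewrite -[RHS]/(PhiN n (k, l) + single (n, _) (x n) (k, l)).
      rewrite /PhiN /single /Phi /= xpair_eqE ltnS leq_eqVlt.
      by case: ltngtP => [kn|kn|->]; rewrite ?addr0 ?add0r.
    by rewrite linearD; apply: S1D => //; apply: (S1X (n, eta n)).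
  have -> : s *: Phi eta = s *: PhiN N.
    apply/funext => -[k l]; rewrite -[LHS]/(s *: Phi eta (k, l)) -[RHS]/(s *: PhiN N (k, l)).
    rewrite /PhiN /Phi /=; case: ltnP => // Nk; case: eqP => // _.
    by rewrite scaler0; have [xk0 _] := xP k; apply: xk0; apply: (Imono _ _ Nk).
  by have := S1Z s _ (S1PhiN N); rewrite -linearZ; congr (S1 (i1 (_, _))); rewrite /= scaler0.
pose phi eta (s : R^o) : M := h1 (i1 (0, (s : R) *: Phi eta)).
have phil eta : linear_on Iinf (phi eta).
  have [h1D h1Z] := h1l.
  split=> [s t Is It|s t It]; rewrite /phi.
    rewrite -h1D; [|exact: S1Phi..]; rewrite -linearD; congr (h1 (i1 (_, _))); first by rewrite /= addr0.
    by rewrite scalerDl.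
  rewrite -h1Z; last exact: S1Phi.
  rewrite -linearZ; congr (h1 (i1 (_, _))); first by rewrite /= scaler0.
  by rewrite /= scalerA.
(* In an injective extension of [M], the map [phi eta] is multiplication by some [z]. Its values lie
   in [C1], so copying [z] into [C2] over [C1] preserves the equations. *)
have [W2 [i2 [bW2 i20]]] := enough_injectives M.
have /choice [y yP] eta : exists y, y \in C2 /\ forall s, Iinf s -> (s : R) *: y = phi eta s.
  have [_ bW2'] := bW2; have [phiD phiZ] := phil eta.
  have [||z _ zE] := bW2' Iinf (i2 \o phi eta) sIinf => //.
    by split=> [s t Is It|s t It] /=; rewrite ?phiD ?phiZ ?linearD ?linearZ.
  have unitL : card_le unit L by apply: card_le_trans natL; exists (fun _ => 0%N) => -[] [].
  have [S2 [h2 [[sS2 S2z _] [[_ h2Z] _ h2C2 h2E]]]] := universal_extension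
    (fun _ : unit => z) natL termL unitL KC1 univ12 bW2 i20.
  exists (h2 z); split=> [|s Is]; first by apply: h2C2; apply: (S2z tt).
  rewrite -h2Z; last exact: (S2z tt).
  by rewrite -zE //= h2E //; apply: h1C1; apply: S1Phi.
have [_ [C2L _]] := univ12; have [{}C2L _] := card_eq_leP C2L.
apply: (@konig B0); apply: card_le_trans C2L.
exists (fun eta => exist _ (y eta) (yP eta).1) => eta eta' [yy].
apply/funext => n; apply: contrapT => nE; case: (xP n) => _; apply.
have Irn : Iinf (r n) by apply: Iinfn (Ir n).
have : phi eta (r n) = phi eta' (r n) by rewrite -!(yP _).2 // yy.
rewrite /phi => hE.
have : i1 (0, r n *: Phi eta) - i1 (0, r n *: Phi eta') = 0.
  apply: h10; first by apply: (submB sS1); apply: S1Phi.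
  by rewrite (linear_onB sS1 h1l) ?hE ?subrr //; apply: S1Phi.
rewrite -linearB => /i10 [_ /eqP]; rewrite subr_eq0 => /eqP.
(* At the coordinate [(n, eta n)] the left side is [r n *: x n], which is nonzero, while the right
   side is 0 because [eta' n] differs from [eta n]. *)
move=> /(congr1 (fun g : F => g (n, eta n))).
rewrite -[LHS]/(r n *: Phi eta (n, eta n)) -[RHS]/(r n *: Phi eta' (n, eta n)).
by rewrite /Phi /= eqxx; case: eqP => // _ ->; rewrite scaler0.
Qed.

End Converse.

Theorem theorem3p17 (R : nzRingType) :
  (left_noetherian R <-> superstable (@absP R)) /\
  (left_noetherian R <-> superstable (@linj R)).
Proof.
split; split.
- move=> noethR; apply: noetherian_superstable => // V S; split.
    exact: noetherian_absP_baer.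
  by move=> /inj_submodP /inj_submod_linj; apply: linj_absP.
- by apply: superstable_noetherian => // V S; apply: linj_absP.
- move=> noethR; apply: noetherian_superstable => // V S; split.
    by move=> /linj_absP; apply: noetherian_absP_baer.
  by move=> /inj_submodP; apply: inj_submod_linj.
- by apply: superstable_noetherian => // V S; apply: linj_absP.
Qed.
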